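(* Let $\mathcal H$ be a regular unitarily invariant space. Then: (i) for every ideal $\mathfrak a\subset\mathcal M(\mathcal H)$, $\operatorname{supp}(\mathfrak a)\cap\mathbb B_d=\mathcal Z_{\mathbb B_d}(\mathfrak a)$ and $\operatorname{supp}(\mathfrak a)\subset\overline{\mathbb B}_d$; (ii) if $\mathfrak a\subset\mathfrak b$ are ideals of $\mathcal M(\mathcal H)$, then $\operatorname{supp}(\mathfrak b)\subset\operatorname{supp}(\mathfrak a)$; (iii) for ideals $\mathfrak a,\mathfrak b\subset\mathcal M(\mathcal H)$, $\operatorname{supp}(\mathfrak a\cap\mathfrak b)=\operatorname{supp}(\mathfrak a)\cup\operatorname{supp}(\mathfrak b)=\operatorname{supp}(\mathfrak a\cdot\mathfrak b)$ and $\operatorname{supp}(\mathfrak a+\mathfrak b)\subset\operatorname{supp}(\mathfrak a)\cap\operatorname{supp}(\mathfrak b)$; (iv) for weak-$*$ closed ideals $\mathfrak a,\mathfrak b\subset\mathcal M(\mathcal H)$, $\operatorname{supp}(\mathfrak a\cdot\mathfrak b)=\operatorname{supp}(\overline{\mathfrak a\cdot\mathfrak b}^{w*})$.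
   Context: A regular unitarily invariant space: a reproducing kernel Hilbert space $\mathcal H$ of holomorphic functions on $\mathbb B_d$ with kernel $K(z,w)=1+\sum_{n\ge1}a_n\langle z,w\rangle^n$, $a_n>0$, $a_n/a_{n+1}\to1$, having the complete Nevanlinna–Pick property. $\mathcal M(\mathcal H)$ is its multiplier algebra (weak-$*$ closed in $B(\mathcal H)$). $\operatorname{supp}(\mathfrak a)=\{z\in\mathbb C^d: 1\notin\mathfrak a+\sum_{j=1}^d(x_j-z_j)\mathcal M(\mathcal H)\}$. $\mathcal Z_{\mathbb B_d}(\mathfrak a)=\{z\in\mathbb B_d:f(z)=0\ \forall f\in\mathfrak a\}$. $\mathfrak a\cdot\mathfrak b$ is the (algebraic) product ideal, and $\overline{\,\cdot\,}^{w*}$ denotes weak-$*$ closure. *)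

(* Defs.v *)
(* R : realType (the real numbers), C := R[i] (complex numbers,
   from mathcomp-real-closed).  Everything below is elementary (epsilon-N). *)
From HB Require Import structures.
From mathcomp Require Import all_boot all_order all_algebra.
From mathcomp Require Import complex.
From mathcomp Require Import reals.
Set Implicit Arguments. Unset Strict Implicit. Unset Printing Implicit Defensive.
Import Order.TTheory GRing.Theory Num.Theory.
Local Open Scope ring_scope.
Local Open Scope complex_scope.

Section UISpaces.
Variable R : realType.
Local Notation C := R[i].
Variable d : nat.

(* Hermitian inner product <z,w> = sum_i z_i conj(w_i) on C^d (row vectors) *)
Definition cdot (z w : 'rV[C]_d) : C := \sum_(i < d) z 0 i * (w 0 i)^*.

(* open unit ball B_d and closed unit ball *)
Definition in_ball (z : 'rV[C]_d) : bool := cdot z z < 1.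
Definition in_cball (z : 'rV[C]_d) : bool := cdot z z <= 1.
Definition Bd := {z : 'rV[C]_d | in_ball z}.

(* functions on the ball *)
Definition fn := Bd -> C.

(* convergence of series in C: partial sums converge to s *)
Definition series_to (u : nat -> C) (s : C) : Prop :=
  forall eps : C, 0 < eps -> exists N : nat, forall n : nat, (N <= n)%N ->
    `|\sum_(i < n.+1) u i - s| < eps.

(* A Hilbert space of functions on B_d together with its kernel functions
   k_w (w in B_d); the axioms are in [is_rkhs_of]. *)
Record rkhs := RKHS {
  mem : fn -> Prop;            (* membership in H *)
  ip  : fn -> fn -> C;         (* inner product, linear in first argument *)
  kf  : Bd -> fn               (* kernel functions: kf w = K(., w) *)
}.

Definition fsub (f g : fn) : fn := fun x => f x - g x.

(* H is a Hilbert function space on B_d with reproducing kernel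
   K(z,w) = 1 + sum_{n>=1} a_n <z,w>^n. *)
Definition is_rkhs_of (a : nat -> R) (H : rkhs) : Prop :=
  (* linear subspace *)
      mem H (fun _ => 0)
    /\ (forall f g, mem H f -> mem H g -> mem H (fun x => f x + g x))
    /\ (forall (c : C) f, mem H f -> mem H (fun x => c * f x))
    /\ (* inner product *)
      (forall f g h, mem H f -> mem H g -> mem H h ->
         ip H (fun x => f x + g x) h = ip H f h + ip H g h)
    /\ (forall (c : C) f g, mem H f -> mem H g ->
         ip H (fun x => c * f x) g = c * ip H f g)
    /\ (forall f g, mem H f -> mem H g -> ip H g f = (ip H f g)^*)
    /\ (forall f, mem H f -> 0 <= ip H f f)
    /\ (forall f, mem H f -> ip H f f = 0 -> f = (fun _ => 0))
    /\ (* completeness *)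
      (forall u : nat -> fn, (forall n, mem H (u n)) ->
         (forall eps : C, 0 < eps -> exists N : nat, forall m n : nat,
             (N <= m)%N -> (N <= n)%N ->
             ip H (fsub (u m) (u n)) (fsub (u m) (u n)) < eps) ->
         exists f, mem H f /\
           (forall eps : C, 0 < eps -> exists N : nat, forall n : nat,
             (N <= n)%N -> ip H (fsub (u n) f) (fsub (u n) f) < eps))
    /\ (* reproducing property *)
      (forall w, mem H (kf H w) /\ forall f, mem H f -> ip H f (kf H w) = f w)
    /\ (* the kernel is K(z,w) = 1 + sum_{n>=1} a_n <z,w>^n *)
      (forall z w : Bd, series_to
         (fun n => if n == 0%N then 1 else (a n)%:C * cdot (val z) (val w) ^+ n)
         (kf H w z)).

(* regularity conditions on the coefficients: a_n > 0 and a_n/a_{n+1} -> 1 *)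
Definition regular_coeffs (a : nat -> R) : Prop :=
  (forall n : nat, (0 < n)%N -> 0 < a n) /\
  (forall eps : R, 0 < eps -> exists N : nat, forall n : nat, (N <= n)%N ->
      `|a n / a n.+1 - 1| < eps).

(* multipliers of H *)
Definition mult (H : rkhs) (phi : fn) : Prop :=
  forall f, mem H f -> mem H (fun x => phi x * f x).

(* r x r matrix-valued multipliers of norm at most 1 on H (x) C^r *)
Definition contractive_mmult (H : rkhs) (r : nat) (Phi : Bd -> 'M[C]_r) : Prop :=
  forall f : 'I_r -> fn, (forall j, mem H (f j)) ->
    let g := fun i x => \sum_(j < r) Phi x i j * f j x in
    (forall i, mem H (g i)) /\
    \sum_(i < r) ip H (g i) (g i) <= \sum_(j < r) ip H (f j) (f j).

Definition adjmx (r : nat) (M : 'M[C]_r) : 'M[C]_r := (map_mx conjc M)^T.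

(* the complete Nevanlinna-Pick property *)
Definition CNP (H : rkhs) : Prop :=
  forall (r n : nat) (lam : 'I_n -> Bd) (W : 'I_n -> 'M[C]_r),
    (forall v : 'I_n -> 'cV[C]_r,
       0 <= \sum_(i < n) \sum_(j < n)
              (((map_mx conjc (v i))^T) *m (1%:M - W i *m adjmx (W j)) *m v j) 0 0
              * kf H (lam j) (lam i)) ->
    exists Phi : Bd -> 'M[C]_r,
      contractive_mmult H Phi /\ forall i, Phi (lam i) = W i.

(* ideals of the multiplier algebra M(H), as sets of functions on B_d *)
Definition ideal (H : rkhs) (A : fn -> Prop) : Prop :=
  (forall f, A f -> mult H f) /\
  A (fun _ => 0) /\
  (forall f g, A f -> A g -> A (fun x => f x + g x)) /\
  (forall phi f, mult H phi -> A f -> A (fun x => phi x * f x)).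

(* coordinate functions x_j *)
Definition coordf (j : 'I_d) : fn := fun x => (val x) 0 j.

(* supp(a) = { z in C^d : 1 \notin a + sum_j (x_j - z_j) M(H) } *)
Definition supp (H : rkhs) (A : fn -> Prop) (z : 'rV[C]_d) : Prop :=
  ~ exists (phi : fn) (psi : 'I_d -> fn),
      A phi /\ (forall j, mult H (psi j)) /\
      (fun x => phi x + \sum_(j < d) (coordf j x - z 0 j) * psi j x)
        = (fun _ => 1).

(* zero set in the ball *)
Definition zero_set (A : fn -> Prop) (x : Bd) : Prop :=
  forall f, A f -> f x = 0.

Definition cap_ideal (A B : fn -> Prop) : fn -> Prop := fun f => A f /\ B f.
Definition sum_ideal (A B : fn -> Prop) : fn -> Prop :=
  fun f => exists g h, A g /\ B h /\ f = (fun x => g x + h x).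
(* algebraic product ideal: finite sums of products *)
Definition prod_ideal (A B : fn -> Prop) : fn -> Prop :=
  fun f => exists (n : nat) (g h : 'I_n -> fn),
    (forall i, A (g i) /\ B (h i)) /\ f = (fun x => \sum_(i < n) g i x * h i x).

(* square-summable sequences in H *)
Definition sq_summable (H : rkhs) (x : nat -> fn) : Prop :=
  (forall n, mem H (x n)) /\ exists s, series_to (fun n => ip H (x n) (x n)) s.

(* weak-* closure in M(H) (subset of B(H) via phi |-> M_phi): the weak-*
   (sigma-weak) topology of B(H) is generated by the normal functionals
   T |-> sum_n <T x_n, y_n> with (x_n), (y_n) square summable; psi lies in
   the closure of A iff every basic neighbourhood of M_psi meets A. *)
Definition wclosure (H : rkhs) (A : fn -> Prop) : fn -> Prop :=
  fun psi => mult H psi /\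
    forall (k : nat) (x y : 'I_k -> nat -> fn),
      (forall i, sq_summable H (x i) /\ sq_summable H (y i)) ->
      forall eps : C, 0 < eps -> exists phi, A phi /\
        forall (i : 'I_k) (s : C),
          series_to (fun n => ip H (fun z => (phi z - psi z) * x i n z) (y i n)) s ->
          `|s| < eps.

Definition wclosed (H : rkhs) (A : fn -> Prop) : Prop :=
  forall psi, wclosure H A psi -> A psi.

End UISpaces.

(* Main.v *)
Require Import Defs.
From HB Require Import structures.
From mathcomp Require Import all_boot all_order all_algebra.
From mathcomp Require Import complex.
From mathcomp Require Import reals.
From mathcomp Require Import boolp classical_sets filter.
From mathcomp Require Import ring lra.
Set Implicit Arguments. Unset Strict Implicit. Unset Printing Implicit Defensive.
Import Order.TTheory GRing.Theory Num.Theory.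
Local Open Scope classical_set_scope.
Local Open Scope ring_scope.

(** Write [k x y = <k_x, k_y>] for the kernel.  The substance is that a multiplier
    [f] with [f p <> 0] satisfies [1 - f / f p = sum_j (x_j - p_j) psi_j] with
    multipliers [psi_j] (Gleason's problem), and that [1 / (|z|^2 - <x, z>)] is a
    multiplier when [|z| > 1].  Inequalities between operators are read as
    positivity of kernels.  For Gleason's problem, let [f p = 0].  Boundedness of [f] gives
    [conj(f x) f(y) k <= M (k - k(., p) - k(p, .) + k(p, p))], and comparing the
    tensors [x^n - p^n] and [x^(n+1) - p^(n+1)], together with [a_n / a_(n+1) -> 1],
    bounds the right-hand side by [M' <x - p, y - p> k].  This is the hypothesis of
    Leech's theorem for [sum_j (x_j - p_j) psi_j = f].  The complete Pick property
    makes [1 - k(x, q) k(q, y) / (k(q, q) k(x, y))] positive for every [q], so that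
    the tangential interpolation problem can be solved one vector at a time on a
    finite set by Parrott's lemma; an ultrafilter limit over finite sets gives the
    [psi_j].  The remaining assertions are ideal arithmetic. *)

(** * Positive kernels *)

(** The kernel is used as [k x y = kf H x y], that is [K(y, x)], so it is antiholomorphic in [x]. A
    multiplier is only known to map the space into itself: its boundedness has to be proved, and its
    adjoint appears only through its action on kernel functions, [k_x] going to [conj (f x) k_x].
    This is why operator inequalities are tested on finite combinations of kernel functions. The
    Pick property enters by bootstrapping. On a finite set containing the origin, where [k] is
    normalised, a factorisation [1 - 1/k = <G, G>] makes [G] admissible interpolation data; the
    property extends [G] to a contractive row on the whole ball, and testing that row at one further
    point enlarges the finite set by that point. In Gleason's problem the recursion from degree [n]
    to [n + 1] carries the factor [(1 + t^2) |p|^2] times a coefficient ratio. It closes because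
    [|p| < 1], provided that all ratios, not only the late ones, are close to 1; hence the passage
    to an equivalent kernel. *)

Section Kernels.
Variable C : numClosedFieldType.

(** Source of the Cauchy-Schwarz inequalities below, by testing [t = - z / b]. The case [b = 0]
    matters because the forms are only semidefinite. *)
Lemma discr_le (a b z : C) : 0 <= a -> 0 <= b ->
  (forall t : C, 0 <= a + t^* * z + t * z^* + t * t^* * b) -> z * z^* <= a * b.
Proof.
move=> a0 b0 H; have [bz|bn0] := eqVneq b 0.
  have [->|zn0] := eqVneq z 0; first by rewrite mul0r mulr_ge0.
  have zc0 : z^* != 0 by rewrite conjC_eq0.
  have ar : a^* = a by apply/CrealP; exact: ger0_real.
  (* With [b = 0] this [t] gives the form the value [-1], so a nonzero [z] is impossible. *)
  have := H (- (a + 1) / (2 * z^*)).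
  have -> : (- (a + 1) / (2 * z^*))^* = - (a + 1) / (2 * z).
    by rewrite rmorphM fmorphV rmorphM rmorph_nat rmorphN rmorphD rmorph1 /= conjCK ar.
  rewrite bz mulr0 addr0.
  have -> : a + - (a + 1) / (2 * z) * z + - (a + 1) / (2 * z^*) * z^* = -1.
    by field; rewrite zn0 zc0.
  by rewrite oppr_ge0 real_leNgt ?ltr01 // ?rpred1 ?rpred0.
have bp : 0 < b by rewrite lt_neqAle eq_sym bn0.
have br : b^* = b by apply/CrealP; exact: ger0_real.
have := H (- z / b); rewrite !(rmorphM, rmorphN, fmorphV) /= br.
have -> : a + - z^* / b * z + - z / b * z^* + - z / b * (- z^* / b) * b = a - z * z^* / b by field.
by rewrite subr_ge0 ler_pdivrMr.
Qed.

Section OneSet.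
Variable T : eqType.
Implicit Types (k : T -> T -> C) (l m : seq (C * T)) (S : T -> Prop).

(** A list stands for the formal combination of its weighted points, repetitions allowed, so that
    sums are concatenations. *)
Definition cross k l m : C :=
  \sum_(x <- l) \sum_(y <- m) x.1 * y.1^* * k x.2 y.2.

Definition supported S l := forall x, x \in l -> S x.2.

(** Relative to a set, because the interpolation arguments control a kernel only on finite sets. *)
Definition posk S k := forall l, supported S l -> 0 <= cross k l l.

Definition scalel (c : C) l := [seq (c * x.1, x.2) | x <- l].

Lemma cross_catl k l1 l2 m : cross k (l1 ++ l2) m = cross k l1 m + cross k l2 m.
Proof. by rewrite /cross big_cat. Qed.

Lemma cross_catr k l m1 m2 : cross k l (m1 ++ m2) = cross k l m1 + cross k l m2.
Proof. by rewrite /cross -big_split; apply: eq_bigr => x _; rewrite big_cat. Qed.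

Lemma cross_scalel k c l m : cross k (scalel c l) m = c * cross k l m.
Proof.
rewrite /cross big_map mulr_sumr; apply: eq_bigr => x _ /=.
by rewrite mulr_sumr; apply: eq_bigr => y _; rewrite !mulrA.
Qed.

Lemma cross_scaler k c l m : cross k l (scalel c m) = c^* * cross k l m.
Proof.
rewrite /cross mulr_sumr; apply: eq_bigr => x _ /=.
rewrite big_map mulr_sumr; apply: eq_bigr => y _ /=.
by rewrite rmorphM; ring.
Qed.

Lemma cross11 k c x e y : cross k [:: (c, x)] [:: (e, y)] = c * e^* * k x y.
Proof. by rewrite /cross !big_seq1. Qed.

Lemma cross_cons k c x l :
  cross k ((c, x) :: l) ((c, x) :: l) =
  c * c^* * k x x + cross k [:: (c, x)] l + cross k l [:: (c, x)] + cross k l l.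
Proof.
by rewrite -cat1s cross_catl !cross_catr cross11 !addrA.
Qed.

Lemma eq_cross S k k' l m : supported S l -> supported S m ->
  (forall x y, S x -> S y -> k x y = k' x y) -> cross k l m = cross k' l m.
Proof.
move=> Sl Sm e; rewrite /cross; apply: eq_big_seq => x xl; apply: eq_big_seq => y ym.
by rewrite e //; [apply: Sl | apply: Sm].
Qed.

Lemma supported_cat S l m : supported S l -> supported S m -> supported S (l ++ m).
Proof. by move=> Sl Sm x; rewrite mem_cat => /orP[/Sl|/Sm]. Qed.

Lemma supported_scalel S c l : supported S l -> supported S (scalel c l).
Proof. by move=> Sl x /mapP[y /Sl Sy ->]. Qed.

Lemma supported1 S c x : S x -> supported S [:: (c, x)].
Proof. by move=> Sx y; rewrite inE => /eqP ->. Qed.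

Arguments supported1 {S} c {x}.
Arguments supported_scalel {S} c {l}.

Lemma posk_eq S k k' : (forall x y, S x -> S y -> k x y = k' x y) ->
  posk S k -> posk S k'.
Proof. by move=> e P l Sl; rewrite -(eq_cross Sl Sl e) P. Qed.

Lemma posk_sub S S' k : (forall x, S' x -> S x) -> posk S k -> posk S' k.
Proof. by move=> sub P l Sl; apply: P => x /Sl /sub. Qed.

Lemma posk_diag S k x : posk S k -> S x -> 0 <= k x x.
Proof.
move=> P Sx; have := P [:: (1, x)] (supported1 _ Sx).
by rewrite cross11 rmorph1 !mul1r.
Qed.

(** Over the complex numbers positivity forces symmetry: the form is real on [x + c y] for [c = 1]
    and for [c = i]. *)
Lemma posk_herm S k x y : posk S k -> S x -> S y -> k y x = (k x y)^*.
Proof.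
move=> P Sx Sy.
have rx := ger0_real (posk_diag P Sx); have ry := ger0_real (posk_diag P Sy).
have sup c : supported S [:: (1, x); (c, y)].
  by move=> z; rewrite !inE => /orP[] /eqP ->.
have q c : cross k [:: (1, x); (c, y)] [:: (1, x); (c, y)] =
    k x x + c * c^* * k y y + (c^* * k x y + c * k y x).
  by rewrite cross_cons !cross11 rmorph1; ring.
have r c : (c * c^*) \is Num.real -> (c^* * k x y + c * k y x) \is Num.real.
  move=> cr; have /ger0_real := P _ (sup c); rewrite q => h.
  have -> : c^* * k x y + c * k y x = (k x x + c * c^* * k y y +
      (c^* * k x y + c * k y x)) - (k x x + c * c^* * k y y) by ring.
  by apply: rpredB => //; rewrite rpredD // rpredM.
have /CrealP h1 := r 1 ltac:(by rewrite rmorph1 mul1r rpred1).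
have /CrealP h2 : ('i^* * k x y + 'i * k y x) \is Num.real.
  by apply: r; rewrite conjCi mulrN -expr2 sqrCi opprK rpred1.
move: h1 h2; rewrite !(rmorphD, rmorphM, rmorph1, rmorphN, conjCi, conjCK) /= !mul1r => h1 h2.
have i0 : ('i : C) != 0 by rewrite neq0Ci.
have h3 : (k y x)^* - (k x y)^* = k x y - k y x.
  apply: (mulfI i0); apply/eqP; rewrite -subr_eq0; apply/eqP.
  by move/eqP: h2; rewrite !conjCi -subr_eq0 -oppr_eq0 => /eqP <-; ring.
have h4 : 2 * (k y x - (k x y)^*) = 0.
  transitivity ((k y x - (k x y)^*) + (k y x - (k x y)^*)); first by ring.
  transitivity ((k x y + k y x - ((k x y)^* + (k y x)^*)) + ((k y x)^* - (k x y)^* - (k x y - k y x))); first by ring.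
  by rewrite h1 h3 !subrr addr0.
by move/eqP: h4; rewrite mulf_eq0 pnatr_eq0 /= subr_eq0 => /eqP.
Qed.

Lemma cross_conj S k l m : posk S k -> supported S l -> supported S m ->
  cross k m l = (cross k l m)^*.
Proof.
move=> P Sl Sm; rewrite /cross exchange_big /= rmorph_sum /=.
apply: eq_big_seq => x /Sl Sx; rewrite rmorph_sum /=; apply: eq_big_seq => y /Sm Sy.
by rewrite (posk_herm P Sx Sy) !rmorphM /= conjCK; ring.
Qed.

Lemma posk_CS S k l m : posk S k -> supported S l -> supported S m ->
  cross k l m * (cross k l m)^* <= cross k l l * cross k m m.
Proof.
move=> P Sl Sm; apply: discr_le; [exact: P|exact: P|move=> t].
have := P (l ++ scalel t m) (supported_cat Sl (supported_scalel _ Sm)).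
rewrite cross_catl !cross_catr !(cross_scalel, cross_scaler) (cross_conj P Sl Sm) !addrA.
by rewrite -mulrA [t * (t^* * _)]mulrA.
Qed.

Lemma crossD k k' l m : cross (fun x y => k x y + k' x y) l m = cross k l m + cross k' l m.
Proof.
rewrite /cross -big_split; apply: eq_bigr => x _; rewrite -big_split.
by apply: eq_bigr => y _; rewrite mulrDr.
Qed.

Lemma crossZ c k l m : cross (fun x y => c * k x y) l m = c * cross k l m.
Proof.
rewrite /cross mulr_sumr; apply: eq_bigr => x _; rewrite mulr_sumr.
by apply: eq_bigr => y _; ring.
Qed.

Lemma crossB k k' l m : cross (fun x y => k x y - k' x y) l m = cross k l m - cross k' l m.
Proof.
rewrite -mulN1r -(crossZ (-1)) -crossD; congr cross.
by apply: funext => x; apply: funext => y; rewrite mulN1r.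
Qed.

Lemma crossM (f g : T -> C) l m : cross (fun x y => f x * (g y)^*) l m =
  (\sum_(x <- l) x.1 * f x.2) * (\sum_(x <- m) x.1 * g x.2)^*.
Proof.
rewrite /cross mulr_suml; apply: eq_bigr => x _; rewrite rmorph_sum mulr_sumr /=.
by apply: eq_bigr => y _; rewrite rmorphM; ring.
Qed.

Lemma poskD S k k' : posk S k -> posk S k' -> posk S (fun x y => k x y + k' x y).
Proof. by move=> P P' l Sl; rewrite crossD addr_ge0 ?P ?P'. Qed.

Lemma poskZ S c k : 0 <= c -> posk S k -> posk S (fun x y => c * k x y).
Proof. by move=> c0 P l Sl; rewrite crossZ mulr_ge0 ?P. Qed.

Lemma posk_rank1 S (g : T -> C) : posk S (fun x y => g x * (g y)^*).
Proof. by move=> l _; rewrite crossM mul_conjC_ge0. Qed.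

Lemma posk_sum S (I : Type) (r : seq I) (k : I -> T -> T -> C) :
  (forall i, posk S (k i)) -> posk S (fun x y => \sum_(i <- r) k i x y).
Proof.
move=> P; elim: r => [|i r IH].
  apply: (@posk_eq _ (fun x y => 0 * (0 : C)^*)) => [x y _ _|]; last exact: posk_rank1.
  by rewrite big_nil mul0r.
apply: (posk_eq _ (poskD (P i) IH)) => x y _ _.
by rewrite big_cons.
Qed.

Lemma crossl1 k l x0 : cross k l [:: (1, x0)] = \sum_(x <- l) x.1 * k x.2 x0.
Proof. by apply: eq_bigr => x _; rewrite big_seq1 rmorph1 mulr1. Qed.

(** Gram kernel of the projections orthogonal to [k_x0]. If [k x0 x0 = 0] the quotient is [0] by the
    convention on inverses, and the claim stays true. *)
Lemma posk_compl S k x0 : posk S k -> S x0 ->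
  posk S (fun x y => k x y - k x x0 * k x0 y / k x0 x0).
Proof.
move=> P Sx0 l Sl; have S1 := supported1 1 Sx0; have r0 := posk_diag P Sx0.
pose k2 x y := (k x0 x0)^-1 * (k x x0 * (k y x0)^*).
rewrite (@eq_cross S _ (fun x y => k x y - k2 x y)) // => [|x y Sx Sy]; last first.
  by rewrite /k2 (posk_herm P Sy Sx0) [X in _ - X]mulrC.
rewrite crossB /k2 crossZ crossM -!crossl1 subr_ge0.
have := posk_CS P Sl S1; rewrite cross11 rmorph1 !mul1r => cs.
have [->|n0] := eqVneq (k x0 x0) 0; first by rewrite invr0 mul0r P.
by rewrite mulrC ler_pdivrMr // lt_neqAle eq_sym n0.
Qed.

Lemma posk0 S k x y : posk S k -> S x -> S y -> k x x = 0 -> k x y = 0.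
Proof.
move=> P Sx Sy k0; have := posk_CS P (supported1 1 Sx) (supported1 1 Sy).
rewrite !cross11 rmorph1 !mul1r k0 mul0r -normCK => h.
have : `|k x y| ^+ 2 == 0 by rewrite eq_le h exprn_ge0.
by rewrite sqrf_eq0 normr_eq0 => /eqP.
Qed.

(* Pivoted Cholesky: one pivot for each point of [s]. *)
Lemma posk_cholesky S k (s : seq T) : posk S k -> (forall x, x \in s -> S x) ->
  exists G : seq (T -> C), let r := fun x y => k x y - \sum_(g <- G) g x * (g y)^* in
    posk S r /\ forall x, x \in s -> r x x = 0.
Proof.
move=> P; elim: s => [|x0 s IH] Ss.
  exists [::]; split=> // l Sl.
  rewrite (@eq_cross S _ k) ?P // => x y _ _; by rewrite big_nil subr0.
have Sx0 : S x0 by apply: Ss; rewrite mem_head.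
have [G [Pr r0]] := IH ltac:(by move=> x xs; apply: Ss; rewrite inE xs orbT).
pose r x y := k x y - \sum_(g <- G) g x * (g y)^*.
have {}Pr : posk S r by [].
have {}r0 x : x \in s -> r x x = 0 by exact: r0.
have rr0 := posk_diag Pr Sx0.
pose h x := r x x0 / sqrtC (r x0 x0).
have hE x y : S y -> h x * (h y)^* = r x x0 * r x0 y / r x0 x0.
  move=> Sy; rewrite /h (posk_herm Pr Sy Sx0) rmorphM fmorphV /=.
  have -> : (sqrtC (r x0 x0))^* = sqrtC (r x0 x0).
    by apply/CrealP; apply: ger0_real; rewrite sqrtC_ge0.
  by rewrite mulrACA -invfM -expr2 sqrtCK.
exists (h :: G); split.
  apply: (posk_eq _ (posk_compl Pr Sx0)) => x y Sx Sy.
  by rewrite big_cons hE // /r; ring.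
move=> x; rewrite big_cons opprD addrCA addrC -/(r x x) inE => /orP[/eqP->|xs].
  rewrite hE //; have [->|n0] := eqVneq (r x0 x0) 0; first by rewrite invr0 mulr0 subr0.
  by rewrite mulfK // subrr.
have Sx : S x by apply: Ss; rewrite inE xs orbT.
by rewrite hE // (r0 _ xs) (posk0 Pr Sx Sx0 (r0 _ xs)) !mul0r subr0.
Qed.

Lemma posk_factor S k (s : seq T) : posk S k -> (forall x, x \in s -> S x) ->
  exists G : seq (T -> C), forall x y, x \in s -> y \in s ->
    k x y = \sum_(g <- G) g x * (g y)^*.
Proof.
move=> P Ss; have [G [Pr r0]] := posk_cholesky P Ss; exists G => x y xs ys.
by apply/eqP; rewrite -subr_eq0; apply/eqP; apply: (posk0 Pr (Ss x xs) (Ss y ys) (r0 x xs)).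
Qed.

Lemma cross_congr (g : T -> C) k l :
  cross (fun x y => g x * (g y)^* * k x y) l l =
  cross k [seq (x.1 * g x.2, x.2) | x <- l] [seq (x.1 * g x.2, x.2) | x <- l].
Proof.
rewrite /cross big_map; apply: eq_bigr => x _; rewrite big_map.
by apply: eq_bigr => y _ /=; rewrite rmorphM; ring.
Qed.

Lemma posk_congr S (g : T -> C) k : posk S k -> posk S (fun x y => g x * (g y)^* * k x y).
Proof. by move=> P l Sl; rewrite cross_congr; apply: P => x /mapP[y /Sl Sy ->]. Qed.

(** On the finite support of [l] one factor is a sum of rank-one kernels, which turns the product
    into a sum of congruences. *)
Lemma posk_schur S k k' : posk S k -> posk S k' -> posk S (fun x y => k x y * k' x y).
Proof.
move=> P P' l Sl.
have [|G GE] := @posk_factor S k [seq x.2 | x <- l] P.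
  by move=> x /mapP[y /Sl Sy ->].
pose k2 x y := \sum_(g <- G) g x * (g y)^* * k' x y.
have P2 : posk S k2 by apply: posk_sum => g; exact: posk_congr.
rewrite (@eq_cross (fun x => x \in [seq x.2 | x <- l]) _ k2) ?P2 //; try exact: map_f.
by move=> x y xl yl; rewrite GE // mulr_suml.
Qed.

Lemma posk_exp S k n : posk S k -> posk S (fun x y => k x y ^+ n).
Proof.
move=> P; elim: n => [|n IH].
  apply: (@posk_eq _ (fun x y => 1 * (1 : C)^*)) => [x y _ _|]; last exact: posk_rank1.
  by rewrite expr0 mul1r rmorph1.
by apply: (posk_eq _ (posk_schur P IH)) => x y _ _; rewrite exprS.
Qed.

Lemma posk_null S S' k : posk S k ->
  (forall x, S' x -> S x \/ forall y, S' y -> k x y = 0 /\ k y x = 0) -> posk S' k.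
Proof.
move=> P H l Sl.
have -> : cross k l l = cross k [seq x <- l | `[< S x.2 >]] [seq x <- l | `[< S x.2 >]].
  rewrite /cross big_filter [RHS]big_mkcond; apply: eq_big_seq => x /Sl Sx.
  case: asboolP => [_|nSx].
    rewrite big_filter [RHS]big_mkcond; apply: eq_big_seq => y /Sl Sy.
    case: asboolP => [//|nSy]; case: (H _ Sy) => // /(_ _ Sx)[_ ->].
    by rewrite mulr0.
  case: (H _ Sx) => // h; apply: big1_seq => y /= /Sl Sy.
  by rewrite (h _ Sy).1 mulr0.
by apply: P => x; rewrite mem_filter => /andP[/asboolP].
Qed.

(** Riesz representation in a finite-dimensional semidefinite space. Domination makes [a] vanish on
    null vectors, hence it lies in the row space of the Gram matrix, which may be singular. *)
Lemma riesz_seq k (a : T -> C) (s : seq T) :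
  posk (fun x => x \in s) k -> posk (fun x => x \in s) (fun x y => k x y - a x * (a y)^*) ->
  exists m, [/\ supported (fun x => x \in s) m,
    forall x, x \in s -> a x = \sum_(y <- m) y.1^* * k x y.2 & cross k m m <= 1].
Proof.
move=> P Pa; pose n := size s; pose t (i : 'I_n) := tnth (in_tuple s) i.
have ts i : t i \in s by exact: mem_tnth.
have supp (v : 'I_n -> C) : supported (fun x => x \in s) [seq (v i, t i) | i <- enum 'I_n].
  by move=> x /mapP[i _ ->] /=.
pose M := \matrix_(i < n, j < n) k (t j) (t i).
pose r := \row_(i < n) a (t i).
have Pa' l : supported (fun x => x \in s) l ->
    `|\sum_(x <- l) x.1 * a x.2| ^+ 2 <= cross k l l.
  by move=> /[dup] Sl /Pa; rewrite crossB crossM subr_ge0 normCK.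
have /submxP[e rE] : (r <= M)%MS.
  rewrite submxE; apply/eqP/matrixP => i0 j; rewrite !mxE.
  pose v i : C := cokermx M i j.
  have Mv i : \sum_(j < n) v j * k (t j) (t i) = 0.
    have h : (M *m cokermx M) i j = 0 by rewrite mulmx_coker mxE.
    by rewrite -[RHS]h mxE; apply: eq_bigr => j0 _; rewrite mulrC [M _ _]mxE.
  pose l := [seq (v i, t i) | i <- enum 'I_n].
  have : cross k l l = 0.
    rewrite /cross exchange_big big_map big1_seq //= => i _.
    rewrite big_map big_enum /=.
    have h : (v i)^* * (\sum_(j < n) v j * k (t j) (t i)) = 0 by rewrite Mv mulr0.
    by rewrite -[RHS]h mulr_sumr; apply: eq_bigr => j0 _; ring.
  move=> c0; have := Pa' l (supp v); rewrite c0 => h.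
  have : `|\sum_(x <- l) x.1 * a x.2| ^+ 2 == 0 by rewrite eq_le h exprn_ge0.
  rewrite sqrf_eq0 normr_eq0 => /eqP; rewrite /l big_map big_enum /= => s0.
  rewrite -[RHS]s0; by apply: eq_bigr => i _; rewrite mulrC [r _ _]mxE.
pose m := [seq ((e 0 i)^*, t i) | i <- enum 'I_n].
have mE x : x \in s -> a x = \sum_(y <- m) y.1^* * k x y.2.
  move=> xs; rewrite /m big_map big_enum /=.
  have [i ->] : exists i, x = t i.
    by have /tnthP[i ->] : x \in in_tuple s by []; exists i.
  move/matrixP/(_ 0 i): rE; rewrite !mxE => ->.
  by apply: eq_bigr => j _; rewrite !mxE conjCK.
exists m; split=> //; first exact: supp.
have c0 := P m (supp _).
(* Testing the domination on the representing vector itself gives [q ^ 2 <= q] for its square norm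
   [q]. *)
have := Pa' m (supp _).
have -> : \sum_(x <- m) x.1 * a x.2 = cross k m m.
  rewrite /cross; apply: eq_big_seq => x xm.
  rewrite mE ?mulr_sumr; last exact: (supp _ _ xm).
  by apply: eq_bigr => y _; rewrite mulrA.
rewrite ger0_norm // expr2; have [-> _|n0] := eqVneq (cross k m m) 0; first exact: ler01.
by rewrite -[X in _ <= X]mulr1 ler_pM2l // lt_neqAle eq_sym n0.
Qed.

Lemma posk_riesz S k m : posk S k -> supported S m -> cross k m m <= 1 ->
  posk S (fun x y => k x y -
    (\sum_(z <- m) z.1^* * k x z.2) * (\sum_(z <- m) z.1^* * k y z.2)^*).
Proof.
move=> P Sm m1 l Sl; rewrite crossB crossM subr_ge0.
have -> : \sum_(x <- l) x.1 * (\sum_(z <- m) z.1^* * k x.2 z.2) = cross k l m.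
  apply: eq_bigr => x _; rewrite mulr_sumr; apply: eq_bigr => z _; exact: mulrA.
apply: le_trans (posk_CS P Sl Sm) _.
by rewrite -[X in _ <= X]mulr1 ler_wpM2l // P.
Qed.

Lemma cross_sum (I : Type) (r : seq I) (k : I -> T -> T -> C) l m :
  cross (fun x y => \sum_(i <- r) k i x y) l m = \sum_(i <- r) cross (k i) l m.
Proof.
rewrite /cross [RHS]exchange_big; apply: eq_bigr => x _ /=.
rewrite [RHS]exchange_big; apply: eq_bigr => y _ /=.
by rewrite mulr_sumr.
Qed.

End OneSet.
Arguments supported1 {T S} c {x}.

(** Congruence by the linear map sending the point [x] to the combination [L x]; several positivity
    proofs below amount to a choice of [L]. *)
Lemma posk_pull (T T' : eqType) (S : T -> Prop) (S' : T' -> Prop) (k : T -> T -> C)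
    (L : T' -> seq (C * T)) :
  posk S k -> (forall x, S' x -> supported S (L x)) ->
  posk S' (fun x y => cross k (L x) (L y)).
Proof.
move=> P H l Sl.
pose l' := flatten [seq scalel x.1 (L x.2) | x <- l].
have -> : cross (fun x y => cross k (L x) (L y)) l l = cross k l' l'.
  rewrite /l' [RHS]/cross big_flatten big_map; apply: eq_bigr => x _.
  transitivity (\sum_(y <- l) cross k (scalel x.1 (L x.2)) (scalel y.1 (L y.2))).
    by apply: eq_bigr => y _; rewrite cross_scalel cross_scaler mulrA.
  rewrite /cross exchange_big; apply: eq_bigr => z _.
  by rewrite big_flatten big_map.
apply: P => z /flattenP[s /mapP[x xl ->]] /mapP[y yL ->] /=.
exact: (H _ (Sl _ xl) _ yL).
Qed.

Lemma posk_comp (T T' : eqType) (S : T -> Prop) (S' : T' -> Prop) (k : T -> T -> C)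
    (f : T' -> T) :
  posk S k -> (forall x, S' x -> S (f x)) -> posk S' (fun x y => k (f x) (f y)).
Proof.
move=> P H; have := @posk_pull _ _ S S' k (fun x => [:: (1, f x)]) P.
move=> /(_ (fun x Sx => supported1 _ (H x Sx))).
by apply: posk_eq => x y _ _; rewrite cross11 rmorph1 !mul1r.
Qed.

End Kernels.
Arguments supported1 {C T S} c {x} _.

(** * Limits along filters *)

Section Limits.
Variables (C : numClosedFieldType) (I : Type) (F : set_system I).
Implicit Types (u v : I -> C).

Definition tends u (l : C) := forall eps : C, 0 < eps -> F [set i | `|u i - l| < eps].

Context {FF : ProperFilter F}.

Lemma tends_eq u v l : F [set i | u i = v i] -> tends u l -> tends v l.
Proof.
by move=> e h eps /h; apply: filterS2 e => i /= ->.
Qed.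

Lemma tends_cst l : tends (fun=> l) l.
Proof. by move=> eps e0; apply: filterE => i /=; rewrite subrr normr0. Qed.

Lemma tendsD u v a b : tends u a -> tends v b -> tends (fun i => u i + v i) (a + b).
Proof.
move=> ua vb eps e0; have e2 : 0 < eps / 2 by rewrite divr_gt0.
apply: filterS2 (ua _ e2) (vb _ e2) => i /= h1 h2.
rewrite opprD addrACA (le_lt_trans (ler_normD _ _)) //.
by rewrite [eps]splitr ltrD.
Qed.

Lemma tendsZ c u a : tends u a -> tends (fun i => c * u i) (c * a).
Proof.
move=> ua eps e0; have n0 : 0 < `|c| + 1 by rewrite ltr_wpDl.
apply: filterS (ua _ (divr_gt0 e0 n0)) => i /= h.
rewrite -mulrBr normrM (@le_lt_trans _ _ ((`|c| + 1) * `|u i - a|)) //.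
  by rewrite ler_wpM2r // lerDl.
by rewrite mulrC -ltr_pdivlMr.
Qed.

Lemma tendsB u v a b : tends u a -> tends v b -> tends (fun i => u i - v i) (a - b).
Proof.
move=> ua vb; rewrite -[- b]mulN1r; apply: (tends_eq _ (tendsD ua (tendsZ (-1) vb))).
by apply: filterE => i /=; rewrite mulN1r.
Qed.

Lemma tends_conj u a : tends u a -> tends (fun i => (u i)^*) a^*.
Proof. by move=> h eps /h; apply: filterS => i /=; rewrite -rmorphB norm_conjC. Qed.

Lemma tends0M u v : tends u 0 -> tends v 0 -> tends (fun i => u i * v i) 0.
Proof.
move=> u0 v0 eps e0; apply: filterS2 (u0 _ ltr01) (v0 _ e0) => i /=.
rewrite !subr0 normrM => h1 h2; rewrite -[eps]mul1r ltr_pM //.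
Qed.

Lemma tendsM u v a b : tends u a -> tends v b -> tends (fun i => u i * v i) (a * b).
Proof.
move=> ua vb.
have u0 : tends (fun i => u i - a) 0 by rewrite -(subrr a); exact: tendsB (tends_cst a).
have v0 : tends (fun i => v i - b) 0 by rewrite -(subrr b); exact: tendsB (tends_cst b).
have -> : a * b = 0 + (a * b + (b * (a - a) + a * (b - b))) by ring.
apply: (tends_eq _ (tendsD (tends0M u0 v0) (tendsD (tends_cst (a * b))
  (tendsD (tendsZ b (tendsB ua (tends_cst a))) (tendsZ a (tendsB vb (tends_cst b))))))).
by apply: filterE => i /=; ring.
Qed.

Lemma tends_sum (J : eqType) (r : seq J) (u : J -> I -> C) a :
  (forall j, j \in r -> tends (u j) (a j)) ->
  tends (fun i => \sum_(j <- r) u j i) (\sum_(j <- r) a j).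
Proof.
elim: r => [|j r IH] h.
  rewrite big_nil; apply: (tends_eq _ (tends_cst 0)).
  by apply: filterE => i /=; rewrite big_nil.
rewrite big_cons; apply: (tends_eq _ (tendsD (h j (mem_head _ _)) (IH _))).
  by apply: filterE => i /=; rewrite big_cons.
by move=> j' jr; apply: h; rewrite inE jr orbT.
Qed.

Lemma le_eps0 (x : C) : (forall eps, 0 < eps -> `|x| < eps) -> x = 0.
Proof.
by move=> h; apply: contrapT => /eqP; rewrite -normr_gt0 => /h; rewrite ltxx.
Qed.

Lemma tends_uniq u a b : tends u a -> tends u b -> a = b.
Proof.
move=> ua ub; apply/eqP; rewrite -subr_eq0; apply/eqP/le_eps0 => eps e0.
have e2 : 0 < eps / 2 by rewrite divr_gt0.
have [i [/= h1 h2]] := filter_ex (filterI (ua _ e2) (ub _ e2)).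
rewrite -(subrKA (u i)) (le_lt_trans (ler_normD _ _)) // [eps]splitr ltrD //.
by rewrite distrC.
Qed.

Lemma tends_ge0 u a : tends u a -> F [set i | 0 <= u i] -> 0 <= a.
Proof.
move=> ua u0.
have ar : a^* = a.
  apply: (@tends_uniq u) => //; apply: tends_eq (tends_conj ua).
  by apply: filterS u0 => i /= /ger0_real/CrealP.
have {}ar : a \is Num.real by apply/CrealP.
rewrite real_leNgt ?rpred0 //; apply/negP => a0.
have /ua h : 0 < - a by rewrite oppr_gt0.
have [i [/= h1 h2]] := filter_ex (filterI h u0).
have : u i - a <= `|u i - a| by rewrite real_ler_norm // rpredB // ger0_real.
by move=> /le_lt_trans/(_ h1); rewrite gtrDr => /(le_lt_trans h2); rewrite ltxx.
Qed.

Lemma tends_cross (T : eqType) (k : I -> T -> T -> C) k0 l m :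
  (forall x y, x \in [seq z.2 | z <- l] -> y \in [seq z.2 | z <- m] ->
    tends (fun i => k i x y) (k0 x y)) ->
  tends (fun i => cross (k i) l m) (cross k0 l m).
Proof.
move=> h; apply: (@tends_sum _ _ (fun x i => _)) => x xl.
apply: (@tends_sum _ _ (fun y i => _)) => y ym.
by apply: tendsZ; apply: h; exact: map_f.
Qed.

Lemma tends_posk (T : eqType) (S : T -> Prop) (k : I -> T -> T -> C) k0 :
  (forall x y, S x -> S y -> tends (fun i => k i x y) (k0 x y)) ->
  (forall i, posk S (k i)) -> posk S k0.
Proof.
move=> h P l Sl.
have ht : tends (fun i => cross (k i) l l) (cross k0 l l).
  by apply: tends_cross => x y /mapP[z /Sl Sz ->] /mapP[w /Sl Sw ->]; exact: h.
by apply: (tends_ge0 ht); apply: filterE => i /=; exact: P.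
Qed.

End Limits.

(** * Limits of bounded functions along an ultrafilter *)

Section UltraLimits.
Variables (R : realType) (I : Type) (U : set_system I).
Hypothesis UU : UltraFilter U.

(** The limit is the supremum of the levels above which [u] stays on a set of [U]. An ultrafilter
    decides every level, so [u] falls below any larger one. *)
Lemma ultra_lim_real (u : I -> R) (M : R) : U [set i | `|u i| <= M] ->
  exists l, forall eps, 0 < eps -> U [set i | `|u i - l| < eps].
Proof.
move=> uM; pose E := [set x : R | U [set i | x <= u i]].
have EM : E (- M) by apply: filterS uM => i /=; rewrite ler_norml => /andP[].
have ubE : ubound E M.
  move=> x Ex; have [i [/= h1 h2]] := filter_ex (filterI Ex uM).
  by rewrite (le_trans h1) // (le_trans (ler_norm _)).
have supE : has_sup E by split; [exists (- M) | exists M].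
exists (sup E) => eps e0.
have [x Ex xs] := sup_adherent e0 supE.
have h1 : U [set i | sup E - eps < u i].
  by apply: filterS Ex => i /=; exact: lt_le_trans.
have h2 : U [set i | u i < sup E + eps].
  have [h|h] := in_ultra_setVsetC [set i | sup E + eps <= u i] UU.
    have := sup_upper_bound supE h; rewrite gerDl leNgt e0.
    by [].
  by apply: filterS h => i /= /negP; rewrite -ltNge.
apply: filterS2 h1 h2 => i /= h1 h2.
by rewrite ltr_distl h1 h2.
Qed.

Lemma ultra_lim (u : I -> R[i]) (M : R) : U [set i | `|u i| <= M%:C%C] ->
  exists l, tends U u l.
Proof.
move=> uM.
have h1 : U [set i | `|complex.Re (u i)| <= M].
  apply: filterS uM => i /= h; rewrite -lecR; exact: le_trans (normc_ge_Re _) h.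
have h2 : U [set i | `|complex.Im (u i)| <= M].
  apply: filterS uM => i /= h; rewrite -lecR.
  have -> : complex.Im (u i) = complex.Re (u i * - 'i%C).
    by case: (u i) => a b; simpc.
  apply: le_trans (normc_ge_Re _) _; rewrite normrM normrN.
  by have -> : `|'i%C : R[i]| = 1; [rewrite normc_def /= expr0n expr1n add0r sqrtr1 | rewrite mulr1].
have [a ha] := ultra_lim_real h1; have [b hb] := ultra_lim_real h2.
exists (a%:C + 'i * b%:C)%C => eps e0.
have [e epsE] : exists e : R, eps = e%:C%C.
  by apply/complex_realP; exact: gtr0_real.
move: e0; rewrite epsE ltcR => e0; have e2 : 0 < e / 2 by rewrite divr_gt0.
apply: filterS2 (ha _ e2) (hb _ e2) => i /= ha' hb'.
have -> : u i - (a%:C + 'i * b%:C)%C = ((complex.Re (u i) - a)%:C + 'i * (complex.Im (u i) - b)%:C)%C.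
  by case: (u i) => p q; simpc.
apply: le_lt_trans (ler_normD _ _) _; rewrite normrM.
have -> : `|'i%C : R[i]| = 1 by rewrite normc_def /= expr0n expr1n add0r sqrtr1.
have -> : e%:C%C = (e / 2)%:C%C + (e / 2)%:C%C by rewrite -rmorphD -splitr.
by rewrite mul1r ltrD // normc_def /= expr0n addr0 sqrtr_sqr ltcR //.
Qed.

End UltraLimits.

(** * Functions and multipliers in a reproducing kernel space *)

Lemma complex_archi (R : realType) (eps : R[i]) : 0 < eps ->
  exists n : nat, (n.+1%:R)^-1 < eps.
Proof.
move=> e0; have [e E] : exists e : R, eps = e%:C%C.
  by apply/complex_realP; exact: gtr0_real.
move: e0; rewrite {}E ltcR => e0.
exists (Num.bound e^-1); rewrite -(rmorph_nat (real_complex R)) -fmorphV ltcR.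
rewrite invf_plt ?posrE // (lt_trans (archi_boundP _)) ?invr_ge0 ?ltW //.
by rewrite ltr_nat.
Qed.

(** Turns Cauchy-Schwarz estimates, which bound squares, into convergence. *)
Lemma tends_sq (C : numClosedFieldType) (I : Type) (F : set_system I) {FF : ProperFilter F}
    (u w : I -> C) l c :
  0 <= c -> F [set i | `|u i - l| ^+ 2 <= c * w i] -> tends F w 0 -> tends F u l.
Proof.
move=> c0 h w0 eps e0.
have c1 : 0 < c + 1 by rewrite ltr_wpDl.
have := w0 (eps ^+ 2 / (c + 1)) (divr_gt0 (exprn_gt0 _ e0) c1).
apply: filterS2 h => i /= h1; rewrite subr0 ltr_pdivlMr // => h2.
rewrite -(ltr_pXn2r (n := 2)) ?nnegrE ?normr_ge0 ?ltW //.
apply: le_lt_trans h2; apply: (@le_trans _ _ `|c * w i|).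
  by rewrite [X in _ <= X]ger0_norm // (le_trans _ h1) // exprn_ge0.
by rewrite normrM mulrC ler_wpM2l // ger0_norm // lerDl.
Qed.

Lemma tends_harmonic (R : realType) : tends \oo (fun n => (n.+1%:R)^-1 : R[i]) 0.
Proof.
move=> eps /complex_archi[N hN]; exists N => // n /= Nn.
rewrite subr0 ger0_norm ?invr_ge0 // (le_lt_trans _ hN) //.
by rewrite lef_pV2 ?posrE // ler_nat.
Qed.

Lemma sqr_norm_sub (C : numClosedFieldType) (x y : C) :
  `|x - y| ^+ 2 <= 2 * (`|x| ^+ 2 + `|y| ^+ 2).
Proof.
rewrite -subr_ge0 !normCK rmorphB /=.
have -> : 2 * (x * x^* + y * y^*) - (x - y) * (x^* - y^*) = (x + y) * (x + y)^*.
  by rewrite rmorphD /=; ring.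
exact: mul_conjC_ge0.
Qed.

Local Notation mem := Defs.mem.

Section Rkhs.
Variables (R : realType) (d : nat) (a : nat -> R) (H : rkhs R d).
Local Notation C := R[i].
Local Notation B := (Bd R d).
Hypothesis HH : is_rkhs_of a H.
Local Notation kap := (kf H).

Lemma mem0 : mem H (fun=> 0). Proof. by case: HH. Qed.
Lemma memD f g : mem H f -> mem H g -> mem H (fun x => f x + g x).
Proof. by case: HH => _ [h _]; exact: h. Qed.
Lemma memZ c f : mem H f -> mem H (fun x => c * f x).
Proof. by case: HH => _ [_] [h _]; exact: h. Qed.
Lemma ipDl f g h : mem H f -> mem H g -> mem H h ->
  ip H (fun x => f x + g x) h = ip H f h + ip H g h.
Proof. by case: HH => _ [_] [_] [e _]; exact: e. Qed.
Lemma ipZl c f h : mem H f -> mem H h -> ip H (fun x => c * f x) h = c * ip H f h.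
Proof. by case: HH => _ [_] [_] [_] [e _]; exact: e. Qed.
Lemma ip_conj f g : mem H f -> mem H g -> ip H g f = (ip H f g)^*.
Proof. by case: HH => _ [_] [_] [_] [_] [e _]; exact: e. Qed.
Lemma ip_ge0 f : mem H f -> 0 <= ip H f f.
Proof. by case: HH => _ [_] [_] [_] [_] [_] [e _]; exact: e. Qed.
Lemma kf_mem w : mem H (kap w).
Proof. by case: HH => _ [_] [_] [_] [_] [_] [_] [_] [_] [e _]; case: (e w). Qed.
Lemma ip_kf w f : mem H f -> ip H f (kap w) = f w.
Proof. by case: HH => _ [_] [_] [_] [_] [_] [_] [_] [_] [e _]; case: (e w) => _ h /h. Qed.

Lemma memB f g : mem H f -> mem H g -> mem H (fsub f g).
Proof.
move=> Hf Hg; have := memD Hf (memZ (-1) Hg).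
by congr mem; apply: funext => x; rewrite mulN1r.
Qed.

Lemma ipBl f g h : mem H f -> mem H g -> mem H h ->
  ip H (fsub f g) h = ip H f h - ip H g h.
Proof.
move=> Hf Hg Hh; rewrite -mulN1r -ipZl // -ipDl //; last exact: memZ.
by congr ip; apply: funext => x; rewrite mulN1r.
Qed.

Lemma ipDr f g h : mem H f -> mem H g -> mem H h ->
  ip H h (fun x => f x + g x) = ip H h f + ip H h g.
Proof.
move=> Hf Hg Hh; rewrite (ip_conj (memD Hf Hg) Hh) ipDl // rmorphD.
by rewrite (ip_conj Hf Hh) (ip_conj Hg Hh).
Qed.

Lemma ipZr c f h : mem H f -> mem H h -> ip H h (fun x => c * f x) = c^* * ip H h f.
Proof. by move=> Hf Hh; rewrite (ip_conj (memZ c Hf) Hh) ipZl // rmorphM (ip_conj Hf Hh). Qed.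

Lemma ipBr f g h : mem H f -> mem H g -> mem H h ->
  ip H h (fsub f g) = ip H h f - ip H h g.
Proof.
move=> Hf Hg Hh; rewrite (ip_conj (memB Hf Hg) Hh) ipBl // rmorphB.
by rewrite (ip_conj Hf Hh) (ip_conj Hg Hh).
Qed.

Lemma ip_CS f g : mem H f -> mem H g -> `|ip H f g| ^+ 2 <= ip H f f * ip H g g.
Proof.
move=> Hf Hg; rewrite normCK; apply: discr_le; rewrite ?ip_ge0 // => t.
have Htg := memZ t Hg.
have := ip_ge0 (memD Hf Htg).
rewrite ipDl ?ipDr ?ipZl ?ipZr //; last exact: memD.
by rewrite (ip_conj Hf Hg) !addrA mulrA.
Qed.

Definition nrm f : C := sqrtC (ip H f f).

Lemma nrm_ge0 f : mem H f -> 0 <= nrm f. Proof. by move=> Hf; rewrite sqrtC_ge0 ip_ge0. Qed.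

Lemma ip_le_nrm f g : mem H f -> mem H g -> `|ip H f g| <= nrm f * nrm g.
Proof.
move=> Hf Hg; rewrite -(ler_pXn2r (n := 2)) ?nnegrE ?mulr_ge0 ?nrm_ge0 //.
by rewrite exprMn !sqrtCK ip_CS.
Qed.

Lemma nrmD f g : mem H f -> mem H g -> nrm (fun x => f x + g x) <= nrm f + nrm g.
Proof.
move=> Hf Hg; have Hfg := memD Hf Hg.
rewrite -(ler_pXn2r (n := 2)) ?nnegrE ?addr_ge0 ?nrm_ge0 //.
rewrite sqrtCK ipDl ?ipDr // sqrrD !sqrtCK (ip_conj Hf Hg).
have -> : ip H f f + ip H f g + ((ip H f g)^* + ip H g g) =
  ip H f f + (ip H f g + (ip H f g)^*) + ip H g g by ring.
rewrite lerD2r lerD2l; apply: le_trans (_ : `|ip H f g + (ip H f g)^*| <= _).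
  by rewrite real_ler_norm // CrealE rmorphD /= conjCK addrC.
rewrite (le_trans (ler_normD _ _)) // norm_conjC mulr2n.
by rewrite lerD // ip_le_nrm.
Qed.

Definition hl (l : seq (C * B)) : fn R d := fun x => \sum_(z <- l) z.1 * kap z.2 x.

Lemma hl_cons z l : hl (z :: l) = fun x => z.1 * kap z.2 x + hl l x.
Proof. by apply: funext => x; rewrite /hl big_cons. Qed.

Lemma hl_mem l : mem H (hl l).
Proof.
elim: l => [|z l IH]; last by rewrite hl_cons; apply: memD => //; apply: memZ; exact: kf_mem.
have := mem0; congr mem; by apply: funext => x; rewrite /hl big_nil.
Qed.

Lemma ip_hl f l : mem H f -> ip H f (hl l) = \sum_(z <- l) z.1^* * f z.2.
Proof.
move=> Hf; elim: l => [|z l IH].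
  have := ipZr 0 Hf Hf; rewrite rmorph0 mul0r big_nil => <-; congr ip.
  by apply: funext => x; rewrite /hl big_nil mul0r.
have Hz : mem H (fun x => z.1 * kap z.2 x) by apply: memZ; exact: kf_mem.
by rewrite hl_cons ipDr ?ipZr ?big_cons ?IH ?ip_kf //; [exact: kf_mem|exact: hl_mem].
Qed.

Lemma ip_hl2 l m : ip H (hl l) (hl m) = cross kap l m.
Proof.
rewrite ip_hl; last exact: hl_mem.
rewrite /cross exchange_big; apply: eq_bigr => z _; rewrite /hl mulr_sumr.
by apply: eq_bigr => w _; ring.
Qed.

Lemma posk_kf S : posk S kap.
Proof. by move=> l _; rewrite -ip_hl2; apply: ip_ge0; exact: hl_mem. Qed.

Lemma hlB l m : fsub (hl l) (hl m) = hl (l ++ scalel (-1) m).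
Proof.
apply: funext => x; rewrite /fsub /hl big_cat; congr (_ + _).
by rewrite big_map -sumrN; apply: eq_bigr => z _; rewrite mulN1r mulNr.
Qed.

Lemma rkhs_complete (u : nat -> fn R d) (e : nat -> C) : (forall n, mem H (u n)) ->
  (forall m n, (n <= m)%N -> ip H (fsub (u m) (u n)) (fsub (u m) (u n)) <= e n) ->
  tends \oo e 0 ->
  exists f, mem H f /\ tends \oo (fun n => ip H (fsub (u n) f) (fsub (u n) f)) 0.
Proof.
move=> Hu ue e0.
have uC m n : ip H (fsub (u m) (u n)) (fsub (u m) (u n)) =
    ip H (fsub (u n) (u m)) (fsub (u n) (u m)).
  by rewrite !ipBl ?ipBr //; [ring|exact: memB|exact: memB].
case: HH => _ [_] [_] [_] [_] [_] [_] [_] [/(_ u Hu) hc _].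
have [|f [Hf hf]] := hc.
  move=> eps /e0[N _ hN]; exists N => m n Nm Nn.
  wlog nm : m n Nm Nn / (n <= m)%N.
    by move=> W; have [|/ltnW] := leqP n m; [exact: W|rewrite uC; exact: W].
  apply: le_lt_trans (ue _ _ nm) _.
  have := hN n Nn; rewrite /= subr0 ger0_norm //.
  by apply: le_trans (ue n n (leqnn _)); apply: ip_ge0; exact: memB.
exists f; split=> // eps /hf[N hN]; exists N => // n /= Nn.
by rewrite subr0 ger0_norm ?hN //; apply: ip_ge0; exact: memB.
Qed.

(* The representing function is the limit of a minimising sequence of
   [|h|^2 - 2 Re <h, g>] over the finite combinations [h] of kernel functions. *)
Lemma mem_of_posk (g : fn R d) (M : C) : 0 <= M ->
  posk (fun=> True) (fun x y => M * kap x y - (g x)^* * g y) -> mem H g.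
Proof.
move=> M0 P.
pose q l := cross kap l l; pose s l : C := \sum_(z <- l) z.1 * (g z.2)^*.
have q0 l : 0 <= q l by apply: (@posk_kf (fun=> True)).
have sq l : s l * (s l)^* <= M * q l.
  have := P l (fun _ _ => I); rewrite crossB crossZ subr_ge0.
  rewrite (@eq_cross _ _ (fun=> True) _ (fun x y => (g x)^* * ((g y)^*)^*)) ?crossM //.
  by move=> x y _ _; rewrite conjCK.
pose J l : C := q l - s l - (s l)^*.
have qr l : (q l)^* = q l by apply/CrealP; exact: ger0_real.
have Jr l : J l \is Num.real by rewrite CrealE /J !rmorphB /= conjCK qr; apply/eqP; ring.
have JM l : - M <= J l.
  rewrite -subr_ge0 opprK; have h := sq l.
  have [qe|qn0] := eqVneq (q l) 0.
    have /eqP : s l * (s l)^* = 0.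
      by apply/eqP; rewrite eq_le mul_conjC_ge0 andbT (le_trans h) // qe mulr0.
    rewrite mul_conjC_eq0 => /eqP se; by rewrite /J qe se conjC0 !subr0 add0r.
  have qp : 0 < q l by rewrite lt_neqAle eq_sym qn0 q0.
  rewrite -(pmulr_rge0 _ qp).
  have -> : q l * (J l + M) = (q l - s l) * (q l - s l)^* + (M * q l - s l * (s l)^*).
    by rewrite /J rmorphB /= qr; ring.
  by rewrite addr_ge0 ?mul_conjC_ge0 // subr_ge0.
pose E := [set r : R | exists l, J l = r%:C%C].
have [M' ME] : exists r : R, M = r%:C%C by apply/complex_realP; exact: ger0_real.
have infE : has_inf E.
  split; first by have /complex_realP[r hr] := Jr [::]; exists r; exists [::].
  by exists (- M') => r [l hl]; have := JM l; rewrite hl ME -rmorphN lecR.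
pose j0 := (inf E)%:C%C.
have Jj0 l : j0 <= J l.
  have /complex_realP[r hr] := Jr l; rewrite hr lecR; apply: ge_inf; first by case: infE.
  by exists l.
(* The discriminant of [J (l + t m) - j0 >= 0] as a form in [t]: a near-minimiser pairs with [m]
   almost as [g] would. *)
have key l m : `|cross kap l m - (s m)^*| ^+ 2 <= (J l - j0) * q m.
  rewrite normCK; apply: discr_le; rewrite ?subr_ge0 // => t.
  rewrite rmorphB /= conjCK -(cross_conj (posk_kf (S := fun=> True))) //.
  have := Jj0 (l ++ scalel t m); rewrite -subr_ge0; congr (_ <= _).
  rewrite /J /q /s cross_catl !cross_catr !cross_scalel !cross_scaler !big_cat /=.
  have -> : \sum_(z <- scalel t m) z.1 * (g z.2)^* = t * s m.
    by rewrite big_map mulr_sumr; apply: eq_bigr => z _; rewrite mulrA.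
  rewrite -/(s l) -/(s m) rmorphD rmorphM /=; ring.
have /choice[l lP] : forall n : nat, exists l, J l < j0 + (n.+1%:R)^-1.
  move=> n; have [|r [l hl] hr] := @inf_adherent _ E (n.+1%:R)^-1 _ infE.
    by rewrite invr_gt0.
  exists l; rewrite hl /j0 -(rmorph_nat (real_complex R)) -fmorphV -rmorphD ltcR //.
pose e n : C := (n.+1%:R)^-1.
have le n : J (l n) - j0 <= e n by rewrite lerBlDl ltW.
have e0 : tends \oo e 0 := @tends_harmonic R.
have e_anti m n : (n <= m)%N -> e m <= e n.
  by move=> nm; rewrite lef_pV2 ?posrE // ler_nat.
have [||f [Hf uf]] := @rkhs_complete (hl \o l) (fun n => 4 * e n) (fun n => hl_mem (l n)).
(* The difference [p] of two near-minimisers is tested against itself, which gives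
   [q p ^ 2 <= 4 * e n * q p]. *)
- move=> m n nm; rewrite /= hlB ip_hl2 -/(q _); set p := _ ++ _.
  have [->|qn0] := eqVneq (q p) 0; first by rewrite mulr_ge0 ?invr_ge0.
  have qp : 0 < q p by rewrite lt_neqAle eq_sym qn0 q0.
  rewrite -(ler_pM2r qp) -expr2.
  have -> : q p = (cross kap (l m) p - (s p)^*) - (cross kap (l n) p - (s p)^*).
    by rewrite /q {1}/p cross_catl cross_scalel; ring.
  set z1 := cross _ _ _ - _; set z2 := cross _ _ _ - _.
  have hz : (z1 - z2) ^+ 2 <= 2 * (`|z1| ^+ 2 + `|z2| ^+ 2).
    apply: (@le_trans _ _ (`|z1 - z2| ^+ 2)).
      have -> : z1 - z2 = q p by rewrite /z1 /z2 /q {3}/p cross_catl cross_scalel; ring.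
      by rewrite ger0_norm.
    exact: sqr_norm_sub.
  apply: le_trans hz _.
  have h1 : `|z1| ^+ 2 <= e n * q p.
    by apply: le_trans (key _ _) _; rewrite ler_pM2r // (le_trans (le _)) // e_anti.
  have h2 : `|z2| ^+ 2 <= e n * q p.
    by apply: le_trans (key _ _) _; rewrite ler_pM2r.
  apply: le_trans (_ : 2 * (e n * q p + e n * q p) <= _).
    by rewrite ler_pM2l // lerD.
  have -> : z1 - z2 = q p by rewrite /z1 /z2 /q {3}/p cross_catl cross_scalel; ring.
  by rewrite le_eqVlt; apply/orP; left; apply/eqP; ring.
- by rewrite -(mulr0 4); exact: tendsZ.
have -> : g = f; last by [].
apply: funext => x; have k0 : 0 <= kap x x by apply: (@posk_diag _ _ (fun=> True)) => //; exact: posk_kf.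
apply: (@tends_uniq _ _ \oo _ (fun n => hl (l n) x)).
  apply: (tends_sq k0 _ e0); apply: filterE => n /=.
  have := key (l n) [:: (1, x)].
  rewrite /q cross11 rmorph1 !mul1r crossl1 /s big_seq1 mul1r conjCK => h.
  by apply: le_trans h _; rewrite mulrC ler_wpM2l.
apply: (tends_sq k0 _ uf); apply: filterE => n /=.
have Hd := memB (hl_mem (l n)) Hf.
have := ip_CS Hd (kf_mem x); rewrite !ip_kf //; last exact: kf_mem.
by rewrite mulrC.
Qed.

Lemma cross_twist (f : fn R d) l :
  cross (fun x y => (f x)^* * f y * kap x y) l l =
  cross kap [seq (z.1 * (f z.2)^*, z.2) | z <- l] [seq (z.1 * (f z.2)^*, z.2) | z <- l].
Proof.
rewrite -(cross_congr (fun x => (f x)^*)); congr cross.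
by apply: funext => x; apply: funext => y; rewrite conjCK.
Qed.

(** The adjoint of a contraction is a contraction: [f] is the adjoint of row [i0] applied to
    [h = hl l], so [<g, h> = |f|^2] and [|g|^2 <= |f|^2]; expanding [|g - h|^2 >= 0] gives
    [|f|^2 <= |h|^2]. *)
Lemma contractive_posk r (Phi : B -> 'M[C]_r) i0 : contractive_mmult H Phi ->
  posk (fun=> True)
    (fun x y => kap x y - \sum_(j < r) (Phi x i0 j)^* * Phi y i0 j * kap x y).
Proof.
move=> hPhi l _; rewrite crossB subr_ge0.
pose f j := hl [seq (z.1 * (Phi z.2 i0 j)^*, z.2) | z <- l].
have Hf j : mem H (f j) := hl_mem _.
have [Hg gf] := hPhi f Hf.
set g := fun x => \sum_(j < r) Phi x i0 j * f j x.
have {}Hg : mem H g := Hg i0.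
pose s := \sum_(j < r) ip H (f j) (f j).
have s0 : 0 <= s by apply: sumr_ge0 => j _; apply: ip_ge0.
have -> : cross (fun x y => \sum_(j < r) (Phi x i0 j)^* * Phi y i0 j * kap x y) l l = s.
  rewrite /s; under [RHS]eq_bigr do rewrite ip_hl2 -(cross_twist (fun x => Phi x i0 _)).
  rewrite /cross [RHS]exchange_big; apply: eq_bigr => x _.
  rewrite [RHS]exchange_big; apply: eq_bigr => y _ /=.
  by rewrite mulr_sumr.
have Hl := hl_mem l.
have gl : ip H g (hl l) = s.
  rewrite ip_hl // /s; under [RHS]eq_bigr do rewrite ip_hl // big_map.
  rewrite [RHS]exchange_big; apply: eq_bigr => z _; rewrite /g mulr_sumr.
  by apply: eq_bigr => j _; rewrite rmorphM /= conjCK mulrA.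
have gg : ip H g g <= s.
  apply: le_trans gf; rewrite (bigD1 i0) //= lerDl; apply: sumr_ge0 => i _.
  apply: ip_ge0; case: (hPhi f Hf) => h _; exact: h.
have := ip_ge0 (memB Hg Hl); rewrite ipBl ?ipBr //; try exact: memB.
rewrite (ip_conj Hg Hl) gl ip_hl2.
have -> : s^* = s by apply/CrealP; exact: ger0_real.
move=> h; rewrite -subr_ge0; apply: le_trans h _.
have -> : ip H g g - s - (s - cross kap l l) = (ip H g g - s) + (cross kap l l - s) by ring.
by rewrite gerDr subr_le0.
Qed.

(* Uniform boundedness by a gliding hump: if [f] were unbounded, [u n] would be
   unit vectors whose pairings with any [G] in [H] are [O(8^-n)]; a signed sum
   of the [4^-n u n] pairs with [u n] at order [4^-n]. *)
Lemma mult_bounded f : mult H f ->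
  exists2 M : C, 0 <= M &
    posk (fun=> True) (fun x y => M * kap x y - (f x)^* * f y * kap x y).
Proof.
move=> Hf; pose tw l := [seq (z.1 * (f z.2)^*, z.2) | z <- l] : seq (C * B).
have tw_scale c l : tw (scalel c l) = scalel c (tw l).
  by rewrite /tw /scalel -!map_comp; apply: eq_map => z /=; rewrite mulrA.
have adj G l : mem H G -> ip H (fun x => f x * G x) (hl l) = ip H G (hl (tw l)).
  move=> HG; rewrite !ip_hl //; last exact: Hf.
  rewrite big_map; apply: eq_bigr => z _ /=.
  by rewrite rmorphM /= conjCK mulrA.
apply: contrapT => no.
have q0 l : 0 <= cross kap l l by apply: (@posk_kf (fun=> True)).
(* Failure of the bound [64 ^ n], after normalisation, yields [h = hl l] of norm below [8^-n] whose
   image under the adjoint has norm [1]. *)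
have exl n : exists l, cross kap (tw l) (tw l) = 1 /\ 64 ^+ n * cross kap l l < 1.
  apply: contrapT => no_l; apply: no; exists (64 ^+ n); first by rewrite exprn_ge0.
  move=> l _; rewrite crossB crossZ cross_twist -/(tw l) subr_ge0.
  set t := cross _ (tw l) _.
  have [->|tn0] := eqVneq t 0; first by rewrite mulr_ge0 ?exprn_ge0.
  have tp : 0 < t by rewrite lt_neqAle eq_sym tn0 q0.
  rewrite real_leNgt ?ger0_real ?mulr_ge0 ?exprn_ge0 ?q0 //.
  apply/negP => lt; apply: no_l; exists (scalel (sqrtC t)^-1 l).
  rewrite tw_scale !cross_scalel !cross_scaler -/t.
  have sr : ((sqrtC t)^-1)^* = (sqrtC t)^-1.
    by apply/CrealP; rewrite ger0_real // invr_ge0 sqrtC_ge0 ltW.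
  have ss x : (sqrtC t)^-1 * ((sqrtC t)^-1 * x) = t^-1 * x.
    by rewrite mulrA -expr2 exprVn sqrtCK.
  rewrite sr !ss mulVf //; split=> //.
  by rewrite mulrCA mulrC ltr_pdivrMr // mul1r.
have [l lP] := choice exl.
pose e n : C := (4 ^+ n)^-1.
have ep n : 0 < e n by rewrite invr_gt0 exprn_gt0.
have eS n : e n = 4 * e n.+1.
  by rewrite /e exprS invfM mulVKf ?pnatr_eq0.
have eh n : e n <= (n.+1%:R)^-1.
  rewrite lef_pV2 ?posrE ?exprn_gt0 // -natrX ler_nat.
  exact: ltn_expl.
pose u n := hl (tw (l n)).
have Hu n : mem H (u n) := hl_mem _.
have uu n : ip H (u n) (u n) = 1 by rewrite ip_hl2; case: (lP n).
(* The two candidate pairings with the unit vector [u n] differ by [2 * e n], so one of them has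
   modulus at least [e n]. *)
pose nx n (G : fn R d) : fn R d :=
  if e n <= `|ip H (fun x => G x + e n * u n x) (u n)| then fun x => G x + e n * u n x
  else fun x => G x + - e n * u n x.
pose G := fix G n : fn R d := if n is n'.+1 then nx n' (G n') else fun=> 0.
have HG n : mem H (G n).
  elim: n => [|n IH]; first exact: mem0.
  by rewrite /= /nx; case: ifP => _; apply: memD => //; exact: memZ.
have Gu n : e n <= `|ip H (G n.+1) (u n)|.
  rewrite /= /nx; case: ifPn => // hn.
  have Heu c : mem H (fun x => c * u n x) by exact: memZ.
  move: hn; rewrite !ipDl ?ipZl // uu !mulr1.
  rewrite -real_ltNge ?ger0_real ?(ltW (ep n)) // => hn.
  set z := ip H (G n) (u n) in hn *.
  have := lerB_dist (2 * e n) (z + e n).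
  have -> : 2 * e n - (z + e n) = - (z - e n) by ring.
  rewrite normrN [`|2 * e n|]ger0_norm ?mulr_ge0 ?(ltW (ep n)) //.
  apply: le_trans; rewrite lerBrDr -lerBrDl; apply: le_trans (ltW hn) _.
  by rewrite mulr_natl mulr2n addrK.
have nu n : nrm (u n) = 1 by rewrite /nrm uu sqrtC1.
have dG n : nrm (fsub (G n.+1) (G n)) <= e n.
  have [c ce ->] : exists2 c, c * c^* = e n ^+ 2 & fsub (G n.+1) (G n) = fun x => c * u n x.
    have er : (e n)^* = e n by apply/CrealP; exact/gtr0_real.
    rewrite /= /nx; case: ifP => _; [exists (e n) | exists (- e n)].
    - by rewrite er.
    - by apply: funext => x; rewrite /fsub addrC addKr.
    - by rewrite rmorphN /= er mulrNN.
    - by apply: funext => x; rewrite /fsub addrC addKr.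
  rewrite /nrm ipZl ?ipZr //; last exact: memZ.
  by rewrite uu mulr1 ce exprCK // ltW.
have dGp p n : nrm (fsub (G (n + p)%N) (G n)) <= 2 * (e n - e (n + p)%N).
  elim: p => [|p IH].
    rewrite addn0 subrr mulr0 le_eqVlt /nrm; apply/orP; left; apply/eqP.
    by rewrite ipBl // ?subrr ?sqrtC0 //; exact: memB.
  have -> : fsub (G (n + p.+1)%N) (G n) =
      fun x => fsub (G (n + p.+1)%N) (G (n + p)%N) x + fsub (G (n + p)%N) (G n) x.
    by apply: funext => x; rewrite /fsub subrKA.
  apply: le_trans (nrmD (memB _ _) (memB _ _)) _ => //.
  apply: le_trans (lerD (_ : _ <= e (n + p)%N) IH) _; first by rewrite addnS; exact: dG.
  rewrite addnS (eS (n + p)%N) -subr_ge0.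
  have -> : 2 * (e n - e (n + p).+1) - (4 * e (n + p).+1 + 2 * (e n - 4 * e (n + p).+1)) =
    2 * e (n + p).+1 by ring.
  by rewrite mulr_ge0 // ltW.
have dG2 m n : (n <= m)%N -> nrm (fsub (G m) (G n)) <= 2 * e n.
  move=> nm; rewrite -(subnKC nm); apply: le_trans (dGp _ _) _.
  by rewrite ler_pM2l // gerBl ltW.
have nrm2 f' : mem H f' -> nrm f' ^+ 2 = ip H f' f' by rewrite /nrm sqrtCK.
have [||g [Hg Gg]] := @rkhs_complete G (fun n => 4 * (n.+1%:R)^-1) HG.
- move=> m n nm; rewrite -nrm2; last exact: memB.
  have := dG2 _ _ nm; rewrite -(ler_pXn2r (n := 2)) ?nnegrE //; last 2 first.
  + by apply: nrm_ge0; exact: memB.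
  + by rewrite mulr_ge0 // ltW.
  move=> /le_trans; apply; rewrite exprMn.
  have -> : (2 : C) ^+ 2 = 4 by rewrite -natrX.
  rewrite ler_pM2l //.
  apply: le_trans (eh n); rewrite expr2 ger_pMr //.
  by apply: le_trans (eh n) _; rewrite invf_le1 // ler1n.
- rewrite -[X in tends _ _ X](mulr0 (4 : C)); apply: tendsZ; exact: tends_harmonic.
have e4 n : 0 <= e n / 4 by rewrite ltW // divr_gt0.
(* Of the [e n] secured at stage [n.+1], later corrections remove at most [2 * e n.+1 = e n / 2],
   and the distance to the limit at most [e n / 4]. *)
have gu n : e n / 4 <= `|ip H g (u n)|.
  have e16 : 0 < (e n / 4) ^+ 2 by rewrite exprn_gt0 // divr_gt0.
  have [N _ hN] := Gg _ e16.
  pose m := (n.+1 + N)%N.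
  have Hm : mem H (fsub (G m) g) by exact: memB.
  have h1 : `|ip H (fsub (G m) g) (u n)| <= e n / 4.
    apply: le_trans (ip_le_nrm Hm (Hu n)) _; rewrite nu mulr1.
    rewrite -(ler_pXn2r (n := 2)) ?nnegrE ?nrm_ge0 //.
    have := hN m (leq_addl _ _); rewrite /= subr0 ger0_norm; last exact: ip_ge0.
    by rewrite nrm2 // => /ltW.
  have Hm' : mem H (fsub (G m) (G n.+1)) by exact: memB.
  have h2 : `|ip H (fsub (G m) (G n.+1)) (u n)| <= e n / 2.
    apply: le_trans (ip_le_nrm Hm' (Hu n)) _; rewrite nu mulr1.
    apply: le_trans (dG2 _ _ (leq_addr _ _)) _.
    by rewrite (eS n) le_eqVlt; apply/orP; left; apply/eqP; field.
  have gE : ip H (G n.+1) (u n) =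
      ip H g (u n) + (ip H (fsub (G m) g) (u n) - ip H (fsub (G m) (G n.+1)) (u n)).
    by rewrite !ipBl //; ring.
  have := Gu n; rewrite gE => h; rewrite -(lerD2r (e n / 4 + e n / 2)).
  have -> : e n / 4 + (e n / 4 + e n / 2) = e n by field.
  apply: le_trans h _; apply: le_trans (ler_normD _ _) _; rewrite lerD2l.
  by apply: le_trans (ler_normB _ _) _; exact: lerD.
have Hfg : mem H (fun x => f x * g x) := Hf _ Hg.
pose K := ip H (fun x => f x * g x) (fun x => f x * g x).
have K0 : 0 <= K by exact: ip_ge0.
(* [e n / 4] is at most the pairing of [f g] with [hl (l n)], hence at most [8^-n] times the norm of
   [f g]. *)
have bound n : 4 ^+ n <= 16 * K.
  have h0 : (e n / 4) ^+ 2 <= `|ip H (fun x => f x * g x) (hl (l n))| ^+ 2.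
    by rewrite ler_pXn2r ?nnegrE // adj // gu.
  have := le_trans h0 (ip_CS Hfg (hl_mem _)); rewrite ip_hl2 -/K => h.
  have p64 : (0 : C) < 64 ^+ n by rewrite exprn_gt0.
  have : 64 ^+ n * (e n / 4) ^+ 2 <= K.
    apply: le_trans (_ : 64 ^+ n * (K * cross kap (l n) (l n)) <= _).
      by rewrite ler_pM2l.
    rewrite mulrCA -[X in _ <= X]mulr1 ler_wpM2l // ltW //.
    by case: (lP n).
  have -> : 64 ^+ n * (e n / 4) ^+ 2 = 4 ^+ n / 16.
    have E : (64 : C) ^+ n = (4 ^+ n) ^+ 3.
      have -> : (64 : C) = 4 ^+ 3 by rewrite -natrX.
      by rewrite -!exprM mulnC.
    have n0 : (4 : C) ^+ n != 0 by rewrite expf_neq0 // pnatr_eq0.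
    rewrite E /e; move: (4 ^+ n) n0 => x n0; by field.
  by rewrite ler_pdivrMr // mulrC.
have p1 : 0 < 16 * K + 1 by rewrite ltr_wpDl // mulr_ge0.
have [n hn] := complex_archi (eps := (16 * K + 1)^-1) ltac:(by rewrite invr_gt0).
have := le_lt_trans (eh n) hn; rewrite /e ltf_pV2 ?posrE ?exprn_gt0 //.
by move=> /lt_le_trans/(_ (bound n)); rewrite gtrDl ltr10.
Qed.

(** The hypothesis bounds the adjoint on kernel combinations; [mem_of_posk] then applies to each
    product [f h] with constant [|h|^2 M]. *)
Lemma mult_of_posk (f : fn R d) (M : C) : 0 <= M ->
  posk (fun=> True) (fun x y => M * kap x y - (f x)^* * f y * kap x y) -> mult H f.
Proof.
move=> M0 P h Hh; apply: (@mem_of_posk _ (ip H h h * M)); first by rewrite mulr_ge0 ?ip_ge0.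
move=> l _; have := P l (fun _ _ => I); rewrite !crossB !crossZ cross_twist.
set tw := map _ l; rewrite !subr_ge0 => tl.
pose g x := f x * h x.
rewrite (@eq_cross _ _ (fun=> True) _ (fun x y => (g x)^* * ((g y)^*)^*)) ?crossM //; last first.
  by move=> x y _ _; rewrite conjCK.
have E : \sum_(x <- l) x.1 * (g x.2)^* = (ip H h (hl tw))^*.
  rewrite ip_hl // big_map rmorph_sum; apply: eq_bigr => z _ /=.
  by rewrite !rmorphM /= !conjCK mulrA.
rewrite E conjCK mulrC -normCK; apply: le_trans (ip_CS Hh (hl_mem _)) _.
by rewrite ip_hl2 -mulrA ler_wpM2l ?ip_ge0.
Qed.

End Rkhs.

(** * The kernel of a complete Pick space *)

Section PickKernel.
Variables (R : realType) (d : nat) (a : nat -> R) (H : rkhs R d).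
Local Notation C := R[i].
Local Notation B := (Bd R d).
Hypothesis HH : is_rkhs_of a H.
Local Notation kap := (kf H).
Local Notation "'everywhere'" := (fun=> True).

Lemma kf_series x y : tends \oo (fun n => \sum_(i < n.+1)
    (if i == 0%N :> nat then 1 else (a i)%:C%C) * cdot (val y) (val x) ^+ i) (kap x y).
Proof.
case: HH => _ [_] [_] [_] [_] [_] [_] [_] [_] [_ /(_ y x) hk] eps /hk[N hN].
exists N => // n /= /hN; congr (`|_ - _| < _); apply: eq_bigr => i _.
by case: eqP => // ->; rewrite expr0 mulr1.
Qed.

Lemma in_ball0 : in_ball (0 : 'rV[C]_d).
Proof. by rewrite /in_ball /cdot big1 ?ltr01 // => i _; rewrite mxE mul0r. Qed.

Definition ball0 : B := exist _ 0 in_ball0.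

Lemma kf_conj x y : kap y x = (kap x y)^*.
Proof. exact: (posk_herm (posk_kf HH (S := everywhere))). Qed.

Lemma kf_0r x : kap x ball0 = 1.
Proof.
apply: (@tends_uniq _ _ \oo _ _ _ _ (kf_series x ball0)).
apply: (@tends_eq _ _ \oo _ (fun=> 1)); last exact: tends_cst.
apply: filterE => n /=.
rewrite big_ord_recl /= mul1r expr0 big1 ?addr0 // => i _.
have -> : cdot (0 : 'rV[C]_d) (val x) = 0 by rewrite /cdot big1 // => j _; rewrite mxE mul0r.
by rewrite expr0n mulr0.
Qed.

Lemma kf_0l x : kap ball0 x = 1.
Proof. by rewrite kf_conj kf_0r rmorph1. Qed.

Lemma kf_diag_ge1 x : 1 <= kap x x.
Proof.
have := posk_diag (x := x) (posk_compl (posk_kf HH (S := everywhere)) (x0 := ball0) I) I.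
by rewrite kf_0r kf_0l !mul1r kf_0l invr1 subr_ge0.
Qed.

Lemma kf_diag_gt0 x : 0 < kap x x.
Proof. exact: lt_le_trans ltr01 (kf_diag_ge1 x). Qed.

(** Multiplication preserves the functions vanishing at [p], the space whose kernel is the
    complement at [p], so a contractive row stays contractive there. In the computation [L x] is the
    projection of [k_x], and [P2] corrects for [h x] differing from [h p]. *)
Lemma posk_compl_mult r (h : 'I_r -> B -> C) p :
  posk everywhere (fun x y => kap x y - (\sum_(j < r) h j x * (h j y)^*) * kap x y) ->
  posk everywhere (fun x y => (kap x y - kap x p * kap p y / kap p p) *
    (1 - \sum_(j < r) h j x * (h j y)^*)).
Proof.
move=> P; have k0 := kf_diag_gt0 p.
pose L x := [:: (1, x); (- kap x p / kap p p, p)].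
have P1 := posk_pull (S' := everywhere) (L := L) P (fun _ _ _ _ => I).
have P2 : posk everywhere (fun x y => (kap p p)^-1 *
    \sum_(j < r) ((h j x - h j p) * kap x p) * ((h j y - h j p) * kap y p)^*).
  apply: poskZ; first by rewrite invr_ge0 ltW.
  by apply: posk_sum => j; apply: (posk_rank1 (fun x => (h j x - h j p) * kap x p)).
apply: (posk_eq _ (poskD P1 P2)) => x y _ _.
rewrite /L /cross !big_cons !big_nil /= !addr0 !rmorph1.
have -> : (- kap y p / kap p p)^* = - kap p y / kap p p.
  by rewrite rmorphM rmorphN fmorphV /= -!kf_conj.
pose S x y := \sum_(j < r) h j x * (h j y)^*; rewrite -!/(S _ _).
have -> : \sum_(j < r) ((h j x - h j p) * kap x p) * ((h j y - h j p) * kap y p)^* =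
   (S x y - S x p - S p y + S p p) * (kap x p * kap p y).
  rewrite /S -!sumrB -big_split mulr_suml; apply: eq_bigr => j _ /=.
  rewrite rmorphM rmorphB /= -kf_conj; ring.
by field; exact: lt0r_neq0.
Qed.

Hypothesis HC : CNP H.

(** The hypothesis says [k = 1 / (1 - <G, G>)] on [s], so [G] is admissible Pick data there and
    extends to a contractive row on the whole ball. The gain is that [p] may lie outside [s]. *)
Lemma cnp_compl (s : seq B) (G : seq (B -> C)) p :
  (forall x y, x \in s -> y \in s -> (1 - \sum_(g <- G) g x * (g y)^*) * kap x y = 1) ->
  posk (fun x => x \in s) (fun x y => (kap x y - kap x p * kap p y / kap p p) *
    (1 - \sum_(g <- G) g x * (g y)^*)).
Proof.
move=> hG; pose t i := tnth (in_tuple s) i.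
have ts i : t i \in s by exact: mem_tnth.
(* Padding [G] by a zero entry makes the matrix size positive, so that [ord0] exists. *)
pose m := size G; pose gg l : B -> C := nth (fun=> 0) G l.
have GE x y : \sum_(g <- G) g x * (g y)^* = \sum_(l < m.+1) gg l x * (gg l y)^*.
  by rewrite (big_nth (fun=> 0)) big_mkord big_ord_recr /= /gg nth_default // mul0r addr0.
(* The Pick property speaks of square matrices, so the conjugated row is stored in row [ord0]. The
   Pick matrix is then [k] on the other rows and the constant [1] on this one. *)
pose W i : 'M[C]_m.+1 := \matrix_(k, l) if k == ord0 then (gg l (t i))^* else 0.
have WW i j k k' : (W i *m adjmx (W j)) k k' =
    if (k == ord0) && (k' == ord0) then \sum_(g <- G) g (t j) * (g (t i))^* else 0.
  rewrite mxE GE; case: (altP (k =P ord0)) => [->|k0] /=; last first.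
    by apply: big1 => l _; rewrite mxE (negbTE k0) mul0r.
  case: (altP (k' =P ord0)) => [->|k0] /=; last first.
    by apply: big1 => l _; rewrite !mxE (negbTE k0) rmorph0 mulr0.
  by apply: eq_bigr => l _; rewrite !mxE /= conjcK mulrC.
have [v|Phi [hPhi PhiW]] := @HC m.+1 (size s) t W.
  have entry i j : ((map_mx conjc (v i))^T *m (1%:M - W i *m adjmx (W j)) *m v j) 0 0 * kap (t j) (t i) =
      \sum_(k < m.+1 | k != ord0) v j k 0 * (v i k 0)^* * kap (t j) (t i) + v j ord0 0 * (v i ord0 0)^*.
    have -> : ((map_mx conjc (v i))^T *m (1%:M - W i *m adjmx (W j)) *m v j) 0 0 =
        \sum_(k < m.+1) v j k 0 * (v i k 0)^* -
        (\sum_(g <- G) g (t j) * (g (t i))^*) * (v j ord0 0 * (v i ord0 0)^*).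
      rewrite mulmxBr mulmx1 mulmxBl !mxE; congr (_ - _).
        by apply: eq_bigr => k _; rewrite !mxE mulrC.
      rewrite (bigD1 ord0) //= [X in _ + X]big1 ?addr0; last first.
        move=> k k0; rewrite mxE big1 ?mul0r // => k' _.
        by rewrite WW (negbTE k0) andbF mulr0.
      rewrite mxE (bigD1 ord0) //= [X in _ + X]big1 ?addr0; last first.
        by move=> k k0; rewrite WW (negbTE k0) mulr0.
      by rewrite WW /= !mxE -mulrA mulrCA [_ * v j _ _]mulrC.
    rewrite (bigD1 ord0) //= -mulr_suml; have := hG _ _ (ts j) (ts i).
    set F := \sum_(g <- G) _; set T := \sum_(k < _ | _) _; set X := _ * _^* => e.
    by transitivity (T * kap (t j) (t i) + X * ((1 - F) * kap (t j) (t i))); [ring | rewrite e mulr1].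
  under eq_bigr do under eq_bigr do rewrite entry.
  under eq_bigr do rewrite big_split exchange_big /=.
  rewrite big_split exchange_big /=; apply: addr_ge0.
    apply: sumr_ge0 => k _.
    have := posk_kf HH (S := everywhere) (l := [seq (v j k 0, t j) | j <- enum 'I_(size s)]).
    move=> /(_ (fun _ _ => I)); rewrite /cross exchange_big big_map big_enum /=.
    congr (_ <= _); apply: eq_bigr => i _.
    by rewrite big_map big_enum.
  under eq_bigr do rewrite -mulr_suml.
  by rewrite -mulr_sumr -rmorph_sum mul_conjC_ge0.
pose h (j : 'I_m.+1) x := (Phi x ord0 j)^*.
have P := contractive_posk HH ord0 hPhi.
have Q : posk everywhere (fun x y => kap x y - (\sum_(j < m.+1) h j x * (h j y)^*) * kap x y).
  apply: (posk_eq _ P) => x y _ _; rewrite mulr_suml; congr (_ - _).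
  by apply: eq_bigr => j _; rewrite /h conjCK.
apply: (posk_eq _ (posk_sub _ (posk_compl_mult p Q))) => // x y xs ys.
congr (_ * (1 - _)); rewrite GE; apply: eq_bigr => j _.
have hE z : z \in s -> h j z = gg j z.
  move=> zs; have [i ->] : exists i, z = t i.
    by have /tnthP[i ->] : z \in in_tuple s by []; exists i.
  by rewrite /h PhiW mxE /= conjCK.
by rewrite !hE.
Qed.

(** If [k(x, p) = 0], the kernel of [cnp_compl] on [x] and the origin is [1] at [(x, x)] and
    [(x, 0)] but [1 - 1 / k(p, p) < 1] at [(0, 0)], against Cauchy-Schwarz. *)
Lemma kf_neq0 x p : kap x p != 0.
Proof.
apply/eqP => e.
have xb : (x == ball0) = false by apply/eqP => xb; move: e; rewrite xb kf_0l => /eqP; rewrite oner_eq0.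
have kx := kf_diag_gt0 x.
pose g y : C := if y == ball0 then 0 else sqrtC (1 - (kap x x)^-1).
have gx : g x * (g x)^* = 1 - (kap x x)^-1.
  rewrite /g xb -normCK ger0_norm ?sqrtCK // sqrtC_ge0 subr_ge0.
  by rewrite invf_le1 // kf_diag_ge1.
have g0 : g ball0 = 0 by rewrite /g eqxx.
have hG y z : y \in [:: x; ball0] -> z \in [:: x; ball0] ->
    (1 - \sum_(f <- [:: g]) f y * (f z)^*) * kap y z = 1.
  have k0 := lt0r_neq0 kx.
  rewrite !inE big_seq1 => /orP[]/eqP-> /orP[]/eqP->.
  - by rewrite gx; field.
  - by rewrite g0 rmorph0 mulr0 subr0 mul1r kf_0r.
  - by rewrite g0 mul0r subr0 mul1r kf_0l.
  - by rewrite g0 mul0r subr0 mul1r kf_0l.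
pose S y : Prop := y \in [:: x; ball0].
have sx : S x by exact: mem_head.
have sb : S ball0 by rewrite /S !inE eqxx orbT.
have := posk_CS (cnp_compl p hG) (supported1 1 sx) (supported1 1 sb).
rewrite !cross11 rmorph1 !mul1r !big_seq1 gx g0 rmorph0 (kf_conj x p) e.
rewrite rmorph0 !(mul0r, mulr0, subr0, mulr1, kf_0l, kf_0r) subKr mulfV ?lt0r_neq0 // !mul1r rmorph1.
by rewrite -subr_ge0 addrAC subrr add0r oppr_ge0 lt_geF ?invr_gt0 ?kf_diag_gt0.
Qed.

(** Points are added one at a time to a set containing the origin. A factorisation on the old set
    gives, through [cnp_compl], the kernel normalised at the new point [p]; its row at [p] vanishes,
    so it is positive on the new set too. *)
Lemma posk_1Bkf S : posk S (fun x y => 1 - (kap x y)^-1).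
Proof.
suff W s : posk (fun x => x \in s ++ [:: ball0]) (fun x y => 1 - (kap x y)^-1).
  move=> l Sl; apply: (W [seq z.2 | z <- l]) => z zl.
  by rewrite mem_cat map_f.
elim: s => [|p s IH].
  move=> l Sl; rewrite /cross big1_seq // => x /= /Sl; rewrite inE => /eqP ->.
  by rewrite big1_seq // => y _; rewrite kf_0l invr1 subrr mulr0.
rewrite cat_cons; move: IH; set s' := s ++ _ => IH.
have b0s : ball0 \in s' by rewrite mem_cat mem_head orbT.
have [G GE] := posk_factor IH (fun x xs => xs).
have kpp := lt0r_neq0 (kf_diag_gt0 p).
have P : posk (fun x => x \in s') (fun x y => 1 - kap x p * kap p y / (kap p p * kap x y)).
  apply: (posk_eq _ (@cnp_compl s' G p _)) => [x y xs ys|x y xs ys]; rewrite -GE //.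
    by field; rewrite kpp kf_neq0.
  by field; rewrite kf_neq0.
have {}P : posk (fun x => x \in p :: s') (fun x y => 1 - kap x p * kap p y / (kap p p * kap x y)).
  apply: (posk_null P) => x; rewrite inE => /orP[/eqP ->|]; [right=> y _ | by left].
  by split; field; rewrite kpp kf_neq0.
pose c x := (kap x p)^-1.
have cc x : (c x)^* = (kap p x)^-1 by rewrite fmorphV /= -kf_conj.
(* These combinations move the normalisation from [p] back to the origin, up to the rank-one kernel
   of [1 - c]. *)
have P1 := @posk_pull _ _ _ _ (fun x => x \in p :: s') _ (fun x => [:: (c x, x); (- c x, ball0)]) P.
have P2 := poskD (poskZ (ltW (kf_diag_gt0 p)) (P1 _)) (@posk_rank1 _ _ _ (fun x : B => 1 - c x)).
apply: (posk_eq _ (P2 _)) => [x y _ _|x xs y]; last first.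
  by rewrite !inE => /orP[] /eqP -> //=; rewrite b0s orbT.
rewrite /cross !big_cons !big_nil /= !addr0 rmorphB rmorphN rmorph1 /= !cc /c !kf_0l !kf_0r.
by field; rewrite kpp !kf_neq0.
Qed.

Lemma posk_pick S p : posk S (fun x y => 1 - kap x p * kap p y / (kap p p * kap x y)).
Proof.
have kpp := lt0r_neq0 (kf_diag_gt0 p).
move=> l Sl; have [|G GE] := @posk_factor _ _ S _ [seq z.2 | z <- l] (@posk_1Bkf S).
  by move=> x /mapP[z /Sl Sz ->].
have hG x y : x \in [seq z.2 | z <- l] -> y \in [seq z.2 | z <- l] ->
    (1 - \sum_(g <- G) g x * (g y)^*) * kap x y = 1.
  by move=> xs ys; rewrite -GE //; field; rewrite kf_neq0.
apply: (posk_eq _ (cnp_compl p hG)) => [x y xs ys|z zl]; last exact: map_f.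
by rewrite -GE //; field; rewrite kpp kf_neq0.
Qed.

End PickKernel.

(** * Leech's theorem *)

Section Leech.
Variables (R : realType) (d : nat) (a : nat -> R) (H : rkhs R d) (r : nat).
Local Notation C := R[i].
Local Notation B := (Bd R d).
Hypothesis HH : is_rkhs_of a H.
Hypothesis HC : CNP H.
Local Notation kap := (kf H).

Definition row_dot (u v : 'rV[C]_r) : C := \sum_(j < r) u 0 j * (v 0 j)^*.

(* A triple [(u, p, c)] records the condition that the sought contraction
   sends [u (x) k_p] to [c k_p]. *)
Definition datum := ('rV[C]_r * B * C)%type.

Definition defect (s t : datum) : C :=
  (row_dot s.1.1 t.1.1 - s.2 * t.2^*) * kap s.1.2 t.1.2.

Lemma posk_row_dot S : posk S (fun s t : datum => row_dot s.1.1 t.1.1).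
Proof. by apply: posk_sum => j; apply: (@posk_rank1 _ _ _ (fun s : datum => s.1.1 0 j)). Qed.

(* Parrott's one-step extension. The compression of the contraction to the
   complement of [k_p] is under control thanks to [posk_pick]; what remains is to
   extend a functional, which is [riesz_seq]. *)
Lemma defect_extend (s : seq datum) u p : posk (fun x => x \in s) defect ->
  exists c, posk (fun x => x \in (u, p, c) :: s) defect.
Proof.
move=> P; have kp := kf_diag_gt0 HH p; have kp0 := lt0r_neq0 kp.
(* The defect once the target is projected orthogonally to [k_p]. At a datum over [p] the second
   term vanishes, so [k2] does not see the unknown [c]. *)
pose k2 (s t : datum) := row_dot s.1.1 t.1.1 * kap s.1.2 t.1.2 -
  s.2 * t.2^* * (kap s.1.2 t.1.2 - kap s.1.2 p * kap p t.1.2 / kap p p).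
have P2 c : posk (fun x => x \in (u, p, c) :: s) k2.
  pose kq (s t : datum) := 1 - kap s.1.2 p * kap p t.1.2 / (kap p p * kap s.1.2 t.1.2).
  have Q1 : posk (fun x => x \in (u, p, c) :: s) (fun s t => defect s t * kq s t).
    apply: (@posk_null _ _ (fun x => x \in s)).
      apply: posk_schur => //.
      exact: (posk_comp (f := fun s : datum => s.1.2) (posk_pick HH HC (S := fun=> True) p)).
    move=> x; rewrite inE => /orP[/eqP -> | xs]; [right | by left] => y _.
    by split; rewrite /defect /kq /=; field; rewrite kp0 (kf_neq0 HH HC).
  have Q2 : posk (fun x => x \in (u, p, c) :: s)
      (fun s t => (kap p p)^-1 * (kap s.1.2 p * (kap t.1.2 p)^* * row_dot s.1.1 t.1.1)).
    apply: poskZ; first by rewrite invr_ge0 ltW.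
    exact: (posk_congr (fun s : datum => kap s.1.2 p) (@posk_row_dot _)).
  apply: (posk_eq _ (poskD Q1 Q2)) => x y _ _.
  by rewrite -(kf_conj HH) /k2 /defect /kq; field; rewrite kp0 (kf_neq0 HH HC).
(* The coordinate of the target along the unit vector [k_p / |k_p|]. *)
pose al (s : datum) := s.2 * kap s.1.2 p / sqrtC (kap p p).
have sk0 : sqrtC (kap p p) != 0 by rewrite sqrtC_eq0.
have defE (x y : datum) : defect x y = k2 x y - al x * (al y)^*.
  have -> : al x * (al y)^* = x.2 * y.2^* * (kap x.1.2 p * kap p y.1.2) / kap p p.
    rewrite /al !rmorphM /= -(kf_conj HH) fmorphV /=.
    have -> : (sqrtC (kap p p))^* = sqrtC (kap p p).
      by apply/CrealP; rewrite ger0_real // sqrtC_ge0 ltW.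
    by rewrite -[in RHS](sqrtCK (kap p p)); field.
  by rewrite /defect /k2; field.
have [||m [ms alE m1]] := @riesz_seq _ _ k2 al s.
- by apply: posk_sub (P2 0) => x xs; rewrite inE xs orbT.
- by apply: posk_eq P => x y _ _; rewrite defE.
pose al' x := \sum_(z <- m) z.1^* * k2 x z.2.
(* The represented functional, evaluated at the new datum, dictates [c]; the [0] is a placeholder in
   an entry that [k2] ignores. *)
exists (al' (u, p, 0) / sqrtC (kap p p)); set c := _ / _.
have k2c y : k2 (u, p, c) y = k2 (u, p, 0) y by rewrite /k2 /=; field.
have al'E x : x \in (u, p, c) :: s -> al x = al' x.
  rewrite inE => /orP[/eqP ->|xs]; last exact: alE.
  rewrite /al' (eq_bigr _ (fun z _ => congr1 _ (k2c z.2))) -/(al' _) /al /c /=.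
  by rewrite -{2}[kap p p]sqrtCK; field.
apply: (posk_eq _ (posk_riesz (P2 c) _ m1)) => [x y xs ys|x /ms xs]; last by rewrite inE xs orbT.
by rewrite defE !al'E.
Qed.

Lemma defect_extend_seq (s : seq datum) (t : seq ('rV[C]_r * B)) :
  posk (fun x => x \in s) defect -> exists s' : seq datum,
    [/\ posk (fun x => x \in s') defect, {subset s <= s'} &
        forall q, q \in t -> exists c, (q, c) \in s'].
Proof.
move=> P; elim: t => [|[u p] t [s' [P' ss' ts']]]; first by exists s; split=> [|x|q] //; rewrite in_nil.
have [c Pc] := defect_extend u p P'.
exists ((u, p, c) :: s'); split=> // [x /ss' xs'|q]; first by rewrite inE xs' orbT.
rewrite inE => /orP[/eqP ->|/ts'[c' h]]; first by exists c; rewrite mem_head.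
by exists c'; rewrite inE h orbT.
Qed.

Variables (b : 'I_r -> B -> C) (f : B -> C).
Hypothesis bf : posk (fun=> True)
  (fun x y => (\sum_(j < r) (b j x)^* * b j y - (f x)^* * f y) * kap x y).

(** The positivity assumed says that sending [conj (b x) (x) k_x] to [conj (f x) k_x] is
    contractive. Extending this to every [e_j (x) k_x] yields the conjugated values of the
    multipliers on [X]. *)
Lemma leech_finite (X : seq B) : exists W : 'I_r -> B -> C,
  (forall x, x \in X -> f x = \sum_(j < r) b j x * W j x) /\
  (forall j, posk (fun x => x \in X) (fun x y => kap x y - (W j x)^* * W j y * kap x y)).
Proof.
pose s0 : seq datum := [seq (\row_j (b j x)^*, x, (f x)^*) | x <- X].
pose t : seq ('rV[C]_r * B) := [seq (delta_mx 0 j, x) | j <- enum 'I_r, x <- X].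
have P0 : posk (fun x => x \in s0) defect.
  apply: (posk_eq _ (posk_comp (f := fun s : datum => s.1.2) bf _)) => // x y /mapP[x' _ ->] /mapP[y' _ ->].
  rewrite /defect /= conjCK; congr ((_ - _) * _).
  by apply: eq_bigr => j _; rewrite !mxE conjCK.
have [s [P ss ts]] := defect_extend_seq t P0.
have /choice[mu muP] : forall q : 'I_r * B, exists c, q.2 \in X -> (delta_mx 0 q.1, q.2, c) \in s.
  move=> [j x]; have [xX|xX] := boolP (x \in X); last by exists 0.
  have [|c hc] := ts (delta_mx 0 j, x); last by exists c.
  by apply/allpairsP; exists (j, x); split; rewrite ?mem_enum.
have dd j j' : row_dot (delta_mx 0 j) (delta_mx 0 j') = (j == j')%:R.
  rewrite /row_dot (bigD1 j) //= big1 ?addr0 => [|i ij]; rewrite !mxE eqxx /= ?eqxx ?rmorph_nat ?mul1r //.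
  by rewrite (negbTE ij) mul0r.
exists (fun j x => (mu (j, x))^*); split=> [x xX|j]; last first.
  apply: (posk_eq _ (posk_comp (f := fun x => (delta_mx 0 j, x, mu (j, x)) : datum) P _)) => [x y xX yX|x xX].
    by rewrite /defect /= dd eqxx conjCK mulrBl mul1r.
  exact: (muP (j, x)).
(* The vector part of this combination is zero, so its defect is minus a square. Positivity makes
   the image zero as well, which is the wanted identity at [x]. *)
pose l : seq (C * datum) := (1, (\row_j (b j x)^*, x, (f x)^*)) ::
  [seq (- (b j x)^*, (delta_mx 0 j, x, mu (j, x))) | j <- enum 'I_r].
have ls : supported (fun x => x \in s) l.
  move=> z; rewrite inE => /orP[/eqP ->|/mapP[j _ ->]] /=; last exact: (muP (j, x)).
  by apply: ss; apply: map_f.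
have lx z : z \in [seq z.2 | z <- l] -> z.1.2 = x.
  by move=> /mapP[y]; rewrite inE => /orP[/eqP -> ->|/mapP[j _ ->] ->].
have := P l ls.
pose k' (y z : datum) := kap x x * (\sum_(j < r) y.1.1 0 j * (z.1.1 0 j)^* - y.2 * z.2^*).
rewrite (@eq_cross _ _ (fun z => z \in [seq z.2 | z <- l]) _ k'); last first.
  by move=> y z /lx ey /lx ez; rewrite /defect ey ez mulrC.
  by move=> z zl; exact: map_f.
  by move=> z zl; exact: map_f.
rewrite /k' crossZ crossB cross_sum (crossM (fun z : datum => z.2)).
rewrite big1 => [|j _]; last first.
  rewrite (crossM (fun z : datum => z.1.1 0 j)) /l big_cons big_map big_enum /=.
  rewrite (bigD1 j) //= big1 => [|i ij]; last by rewrite !mxE eqxx eq_sym (negbTE ij) mulr0.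
  by rewrite !mxE !eqxx mulr1 mul1r addr0 subrr mul0r.
rewrite sub0r -normCK mulrN oppr_ge0 pmulr_rle0 ?(kf_diag_gt0 HH) // => h.
have : `|\sum_(z <- l) z.1 * z.2.2| ^+ 2 == 0 by rewrite eq_le h exprn_ge0.
rewrite sqrf_eq0 normr_eq0 /l big_cons big_map big_enum /= mul1r.
under eq_bigr do rewrite mulNr.
rewrite sumrN subr_eq0 => /eqP e; rewrite -[LHS]conjCK e rmorph_sum.
by apply: eq_bigr => j _; rewrite /= rmorphM /= conjCK.
Qed.

Lemma leech : exists psi : 'I_r -> B -> C,
  (forall j, mult H (psi j)) /\ forall x, f x = \sum_(j < r) b j x * psi j x.
Proof.
have /choice[W WP] := leech_finite.
(* Along [F] the set [X] eventually contains any given finite set. The identity and the positivity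
   each involve finitely many points, so they survive the limit. *)
pose F := filter_from setT (fun X0 : seq B => [set X : seq B | {subset X0 <= X}]).
have FF : ProperFilter F.
  apply: filter_from_proper; last by move=> X _; exists X => x.
  apply: filter_from_filter; first by exists [::].
  move=> X Y _ _; exists (X ++ Y) => // Z /= h.
  by split=> z zX; apply: h; rewrite mem_cat zX ?orbT.
have [U [UU FU]] := ultraFilterLemma FF.
have near_mem (X0 : seq B) : U [set X : seq B | {subset X0 <= X}] by apply: FU; exists X0.
have bnd j x : U [set X | `|W X j x| <= 1%:C%C].
  apply: filterS (near_mem [:: x]) => X /= /(_ x (mem_head _ _)) xX.
  have := posk_diag (x := x) ((WP X).2 j) xX.
  rewrite [_^* * _]mulrC -normCK -{1}[kap x x]mul1r -mulrBl pmulr_lge0 ?(kf_diag_gt0 HH) //.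
  by rewrite subr_ge0 expr_le1.
have /choice[psi psiP] : forall q : 'I_r * B, exists l, tends U (fun X => W X q.1 q.2) l.
  by move=> [j x]; exact: ultra_lim (bnd j x).
exists (fun j x => psi (j, x)); split=> [j|x].
  apply: (mult_of_posk HH (M := 1)) => // l _.
  pose k X x y := kap x y - (W X j x)^* * W X j y * kap x y.
  have kt : tends U (fun X => cross (k X) l l)
      (cross (fun x y => 1 * kap x y - (psi (j, x))^* * psi (j, y) * kap x y) l l).
    apply: tends_cross => x y _ _; rewrite mul1r; apply: tendsB; first exact: tends_cst.
    apply: tendsM (tends_cst _); apply: tendsM; last exact: (psiP (j, y)).
    exact: tends_conj (psiP (j, x)).
  apply: (tends_ge0 kt); apply: filterS (near_mem [seq z.2 | z <- l]) => X /= sX.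
  by apply: (WP X).2 => z zl; apply: sX; exact: map_f.
apply: (@tends_uniq _ _ U _ (fun X => \sum_(j < r) b j x * W X j x)); last first.
  by apply: tends_sum => j _; apply: tendsZ; exact: (psiP (j, x)).
apply: (@tends_eq _ _ U _ (fun=> f x)); last exact: tends_cst.
apply: filterS (near_mem [:: x]) => X /= /(_ x (mem_head _ _)) xX.
exact: (WP X).1.
Qed.

End Leech.

(** * Power series kernels *)

Section KernelSeries.
Variables (R : realType) (d : nat).
Local Notation C := R[i].
Local Notation B := (Bd R d).
Local Notation "'everywhere'" := (fun=> True).

(** The arguments are swapped to agree with [kf H x y = K(y, x)]. *)
Definition gram (x y : B) : C := cdot (val y) (val x).

Lemma posk_cdot (T : eqType) (S : T -> Prop) (v : T -> 'rV[C]_d) :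
  posk S (fun x y => cdot (v y) (v x)).
Proof.
have P : posk S (fun x y => \sum_(j < d) (v x 0 j)^* * ((v y 0 j)^*)^*).
  by apply: posk_sum => j; apply: (@posk_rank1 _ _ _ (fun x => (v x 0 j)^*)).
apply: (posk_eq _ P) => x y _ _.
by apply: eq_bigr => j _; rewrite conjCK mulrC.
Qed.

Lemma posk_gram S : posk S gram.
Proof. exact: (@posk_cdot _ _ (fun x : B => val x)). Qed.

Definition psum (b : nat -> C) (m : nat) (x y : B) : C := \sum_(i < m.+1) b i * gram x y ^+ i.

Definition kseries b k := forall x y, tends \oo (fun m => psum b m x y) (k x y).

Lemma tends_shift (u : nat -> C) l : tends \oo u l -> tends \oo (fun n => u n.+1) l.
Proof. by move=> h eps /h[N _ hN]; exists N => // n /= Nn; apply: hN; exact: leqW. Qed.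

Lemma posk_psum S b m : (forall n, 0 <= b n) -> posk S (psum b m).
Proof.
by move=> b0; apply: posk_sum => i; apply: poskZ => //; apply: posk_exp; exact: posk_gram.
Qed.

Lemma kseries_comb (b b' k k' : _) (c : C) : kseries b k -> kseries b' k' ->
  kseries (fun n => c * b' n - b n) (fun x y => c * k' x y - k x y).
Proof.
move=> h h' x y; apply: (@tends_eq _ _ \oo _ (fun m => c * psum b' m x y - psum b m x y)).
  apply: filterE => m /=; rewrite /psum mulr_sumr -sumrB; apply: eq_bigr => i _; ring.
by apply: tendsB; [apply: tendsZ|].
Qed.

Lemma kseries_posk S b k : (forall n, 0 <= b n) -> kseries b k -> posk S k.
Proof.
by move=> b0 h; apply: (tends_posk (F := \oo)) => [x y _ _|m]; [exact: h|exact: posk_psum].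
Qed.

Lemma kseries_le S b b' k k' (c : C) : kseries b k -> kseries b' k' ->
  (forall n, b n <= c * b' n) -> posk S (fun x y => c * k' x y - k x y).
Proof.
move=> h h' le; apply: kseries_posk (kseries_comb c h h') => n.
by rewrite subr_ge0.
Qed.

(** * Gram kernels of the differences [k_x - k_p] *)

Section Differences.
Variable p : B.

Definition bdiff (k : B -> B -> C) x y := k x y - k x p - k p y + k p p.

Lemma bdiff_cross k x y : cross k [:: (1, x); (-1, p)] [:: (1, y); (-1, p)] = bdiff k x y.
Proof. by rewrite /cross !big_cons !big_nil /= rmorphN rmorph1 /bdiff; ring. Qed.

Lemma posk_bdiff k : posk everywhere k -> posk everywhere (bdiff k).
Proof.
move=> P; have := @posk_pull _ _ _ everywhere everywhere _ (fun x => [:: (1, x); (-1, p)]) P (fun _ _ _ _ => I).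
by apply: posk_eq => x y _ _; rewrite bdiff_cross.
Qed.

Local Notation D n := (bdiff (fun x y => gram x y ^+ n)).

(** Write [x^(n+1) - p^(n+1)] as [u + v] with [u = x^n (x) (x - p)] and [v = (x^n - p^n) (x) p]. The
    gap in [|u + v|^2 <= (1 + t^-2) |u|^2 + (1 + t^2) |v|^2] is [|t^-1 u - t v|^2], and [L x] is
    this last vector. *)
Lemma bdiff_step n (t : C) : 0 < t -> posk everywhere (fun x y =>
  (1 + t^-2) * (D 1 x y * gram x y ^+ n) + (1 + t ^+ 2) * gram p p * D n x y - D n.+1 x y).
Proof.
move=> t0; have tr : t^* = t by apply/CrealP; exact: gtr0_real.
have P : posk (fun _ : B * B => True) (fun u v => gram u.1 v.1 ^+ n * gram u.2 v.2).
  apply: posk_schur; last exact: (@posk_cdot _ _ (fun u : B * B => val u.2)).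
  by apply: posk_exp; exact: (@posk_cdot _ _ (fun u : B * B => val u.1)).
pose L x : seq (C * (B * B)) := [:: (t^-1, (x, x)); (- t^-1 - t, (x, p)); (t, (p, p))].
have := @posk_pull _ _ _ _ everywhere _ L P (fun _ _ _ _ => I).
apply: posk_eq => x y _ _.
have c1 : (t^-1)^* = t^-1 by rewrite fmorphV /= tr.
have c2 : (- t^-1 - t)^* = - t^-1 - t by rewrite rmorphB rmorphN /= c1 tr.
rewrite /cross !big_cons !big_nil /= c2 c1 tr /bdiff !exprS !expr0.
by field; rewrite lt0r_neq0.
Qed.

(** Weight [bdiff_step] in degree [n] by [b n.+1 <= A * b n] and sum over [n]; the multiple of
    [bdiff k] on the right is absorbed on the left. *)
Lemma bdiff_bound (b : nat -> C) k (t A : C) : 0 < t -> 0 <= A ->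
  (forall n, 0 <= b n) -> (forall n, b n.+1 <= A * b n) -> kseries b k ->
  posk everywhere (fun x y => A * (1 + t^-2) * (bdiff gram x y * k x y) -
    (1 - A * (1 + t ^+ 2) * gram p p) * bdiff k x y).
Proof.
move=> t0 A0 b0 bA kS.
have t1 : 0 <= 1 + t^-2 by rewrite addr_ge0 // invr_ge0 exprn_ge0 // ltW.
have t2 : 0 <= 1 + t ^+ 2 by rewrite addr_ge0 // exprn_ge0 // ltW.
have gp : 0 <= gram p p := posk_diag (posk_gram (S := everywhere)) (I : everywhere p).
(* The truncation orders differ by one because degree [i.+1] is bounded by degree [i]; the
   difference in degree zero vanishes. *)
pose km m x y := A * (1 + t^-2) * (bdiff gram x y * psum b m x y) +
    A * (1 + t ^+ 2) * gram p p * bdiff (psum b m) x y - bdiff (psum b m.+1) x y.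
apply: (tends_posk (F := \oo) (k := km)) => [x y _ _|m].
  have -> : A * (1 + t^-2) * (bdiff gram x y * k x y) - (1 - A * (1 + t ^+ 2) * gram p p) * bdiff k x y =
    A * (1 + t^-2) * (bdiff gram x y * k x y) + A * (1 + t ^+ 2) * gram p p * bdiff k x y - bdiff k x y.
    by ring.
  have bt : tends \oo (fun m => bdiff (psum b m) x y) (bdiff k x y).
    by apply: tendsD (kS p p); apply: tendsB (kS p y); apply: tendsB (kS x y) (kS x p).
  apply: tendsB; last exact: (tends_shift bt).
  by apply: tendsD; apply: tendsZ => //; apply: tendsZ; exact: kS.
pose Q n x y := (1 + t^-2) * (D 1 x y * gram x y ^+ n) + (1 + t ^+ 2) * gram p p * D n x y.
have Qp n : posk everywhere (Q n).
  have gn := posk_exp n (posk_gram (S := everywhere)).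
  apply: poskD; apply: poskZ; rewrite ?mulr_ge0 //; last exact: posk_bdiff.
  by apply: posk_schur gn; apply: posk_bdiff; apply: posk_exp; exact: posk_gram.
have bdiff_psum n x y : bdiff (psum b n) x y = \sum_(i < n.+1) b i * D i x y.
  by rewrite /bdiff /psum -!sumrB -big_split; apply: eq_bigr => i _ /=; ring.
have P : posk everywhere (fun x y => \sum_(i < m.+1) (b i.+1 * (Q i x y - D i.+1 x y) +
     (A * b i - b i.+1) * Q i x y)).
  apply: posk_sum => i; apply: poskD; apply: poskZ; rewrite ?subr_ge0 //.
  exact: bdiff_step.
apply: (posk_eq _ P) => x y _ _; rewrite /km !bdiff_psum /Q.
have D0 : D 0 x y = 0 by rewrite /bdiff !expr0; ring.
rewrite [in X in _ = _ - X]big_ord_recl D0 mulr0 add0r; move: (gram p p) => gpp.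
rewrite /psum [bdiff gram x y * _]mulr_sumr !mulr_sumr -big_split -sumrB.
apply: eq_bigr => i _; rewrite lift0 /=.
have -> : bdiff gram x y = D 1 x y by rewrite /bdiff !expr1.
ring.
Qed.

End Differences.

(** The row of coordinate multiplications has squared norm at most [A]: the coefficient of
    [gram ^ n.+1] is [A * b n.+1 - b n]. *)
Lemma gram_shift (b : nat -> C) k (A : C) : 0 <= A -> (forall n, 0 <= b n) ->
  (forall n, b n <= A * b n.+1) -> kseries b k ->
  posk everywhere (fun x y => A * k x y - gram x y * k x y).
Proof.
move=> A0 b0 bA kS; pose km m x y := A * psum b m.+1 x y - gram x y * psum b m x y.
apply: (tends_posk (F := \oo) (k := km)) => [x y _ _|m].
  by apply: tendsB; apply: tendsZ; [apply: (tends_shift (kS x y))|exact: kS].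
have P : posk everywhere (fun x y => A * b 0%N * gram x y ^+ 0 +
    \sum_(i < m.+1) (A * b i.+1 - b i) * gram x y ^+ i.+1).
  apply: poskD; first by apply: poskZ; [rewrite mulr_ge0|apply: posk_exp; exact: posk_gram].
  by apply: posk_sum => i; apply: poskZ; [rewrite subr_ge0|apply: posk_exp; exact: posk_gram].
apply: (posk_eq _ P) => x y _ _; rewrite /km /psum [in X in _ = A * X - _]big_ord_recl.
move: (gram x y) => z; rewrite mulrDr !mulr_sumr -addrA -sumrB mulrA; congr (_ + _).
by apply: eq_bigr => i _; rewrite lift0 /= exprS; ring.
Qed.

End KernelSeries.

(** * Regular spaces *)

Section RegularSpace.
Variables (R : realType) (d : nat) (a : nat -> R) (H : rkhs R d).
Local Notation C := R[i].
Local Notation B := (Bd R d).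
Local Notation "'everywhere'" := (fun=> True).
Hypothesis HH : is_rkhs_of a H.
Hypothesis HR : regular_coeffs a.
Local Notation kap := (kf H).

Definition coef n : R := if n == 0%N then 1 else a n.

Lemma coef_gt0 n : 0 < coef n.
Proof. by rewrite /coef; case: eqP => // /eqP n0; apply: HR.1; rewrite lt0n. Qed.

Lemma kf_kseries : kseries (fun n => (coef n)%:C%C) kap.
Proof.
move=> x y; apply: (@tends_eq _ _ \oo _ _ _ _ _ (kf_series HH x y)).
apply: filterE => m /=; apply: eq_bigr => i _; rewrite /coef /gram.
by case: (i == 0%N :> nat).
Qed.

Lemma coef_ratio (e : R) : 0 < e -> exists N, forall n, (N <= n)%N ->
  coef n.+1 <= (1 + e) * coef n /\ coef n <= (1 + e) * coef n.+1.
Proof.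
move=> e0; have e1 : 0 < 1 + e by rewrite addr_gt0.
(* This deviation keeps the ratio between [1 - e / (1 + e) = 1 / (1 + e)] and [1 + e]. *)
have [N hN] := HR.2 (e / (1 + e)) (divr_gt0 e0 e1).
(* Index [0] is excluded because [coef 0] is [1], whatever [a 0] is. *)
exists (maxn N 1) => n; rewrite geq_max => /andP[Nn n1].
have -> : coef n = a n by rewrite /coef -(negbK (n == 0%N)) -lt0n n1.
rewrite /coef /=; have an := HR.1 n n1; have an1 := HR.1 n.+1 isT.
have := hN n Nn; rewrite ltr_distl => /andP[h1 h2].
have xE : a n = a n / a n.+1 * a n.+1 by rewrite divfK // lt0r_neq0.
split; rewrite xE.
  rewrite mulrA -[X in X <= _]mul1r ler_pM2r //.
  apply: le_trans (_ : (1 + e) * (1 - e / (1 + e)) <= _); last by rewrite ler_pM2l // ltW.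
  by rewrite le_eqVlt; apply/orP; left; apply/eqP; field; exact: lt0r_neq0.
rewrite ler_pM2r //; apply: le_trans (ltW h2) _.
by rewrite lerD2l ler_pdivrMr // ler_peMr ?ltW // ltrDl.
Qed.

(* Flattening finitely many coefficients makes all consecutive ratios close to [1],
   at the cost of an equivalent kernel. *)
Lemma regular_majorant (e : R) : 0 < e -> exists (b : nat -> C) (k : B -> B -> C) (M : C),
  [/\ forall n, 0 <= b n,
      forall n, b n.+1 <= (1 + e)%:C%C * b n /\ b n <= (1 + e)%:C%C * b n.+1,
      kseries b k, 0 <= M &
      posk everywhere (fun x y => M * k x y - kap x y) /\
      posk everywhere (fun x y => M * kap x y - k x y)].
Proof.
move=> e0; have [N hN] := coef_ratio e0.
pose b n := coef (maxn n N).
have b0 n : 0 < b n := coef_gt0 _.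
pose M := 1 + \sum_(i < N.+1) (coef i / coef N + coef N / coef i).
have q0 i j : 0 < coef i / coef j by rewrite divr_gt0 ?coef_gt0.
have s0 (I : Type) (r : seq I) P (f : I -> nat) :
    0 <= \sum_(i <- r | P i) (coef (f i) / coef N + coef N / coef (f i)).
  by apply: sumr_ge0 => i _; rewrite addr_ge0 // ltW.
have M0 : 0 <= M by rewrite addr_ge0.
have cmp n : coef n <= M * b n /\ b n <= M * coef n.
  rewrite /b; have [Nn|nN] := leqP N n.
    have M1 : 1 <= M by rewrite lerDl.
    by split; apply: ler_peMl => //; apply: ltW; exact: coef_gt0.
  have MM : coef n / coef N + coef N / coef n <= M.
    have nN1 : (n < N.+1)%N by exact: ltnW.
    rewrite /M (bigD1 (Ordinal nN1)) //= addrCA lerDl addr_ge0 //.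
  split; rewrite -ler_pdivrMr ?coef_gt0 //; apply: le_trans MM.
    by rewrite lerDl ltW.
  by rewrite lerDr ltW.
pose k x y := kap x y + \sum_(i < N) (b i - coef i)%:C%C * gram x y ^+ i.
have kS : kseries (fun n => (b n)%:C%C) k.
  move=> x y eps /(kf_kseries x y)[m0 _ h].
  exists (maxn m0 N) => // m /=; rewrite geq_max => /andP[/h /= hm Nm].
  apply: le_lt_trans hm; rewrite le_eqVlt; apply/orP; left; apply/eqP; congr `|_|.
  have -> : psum (fun n => (b n)%:C%C) m x y = psum (fun n => (coef n)%:C%C) m x y +
      \sum_(i < N) (b i - coef i)%:C%C * gram x y ^+ i.
    have -> : \sum_(i < N) (b i - coef i)%:C%C * gram x y ^+ i =
        \sum_(i < m.+1) (b i - coef i)%:C%C * gram x y ^+ i.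
      rewrite -!(big_mkord xpredT (fun i => (b i - coef i)%:C%C * gram x y ^+ i)).
      rewrite [RHS](@big_cat_nat _ _ _ N) //=; last exact: leqW.
      rewrite [X in _ = _ + X]big1_seq ?addr0 // => i /=; rewrite mem_index_iota => /andP[Ni _].
      by rewrite /b (maxn_idPl Ni) subrr mul0r.
    by rewrite /psum -big_split; apply: eq_bigr => i _; rewrite rmorphB /=; ring.
  by rewrite /k; ring.
exists (fun n => (b n)%:C%C), k, M%:C%C; split=> //.
- by move=> n; rewrite ler0c ltW.
- move=> n; rewrite -!rmorphM !lecR /b.
  have [Nn|nN] := leqP N n; first by rewrite (maxn_idPl (leqW Nn)); exact: hN.
  rewrite (maxn_idPr nN); have e1 : 1 <= 1 + e by rewrite lerDl ltW.
  by split; apply: ler_peMl => //; apply: ltW; exact: coef_gt0.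
- by rewrite ler0c.
split; [apply: kseries_le kf_kseries kS _|apply: kseries_le kS kf_kseries _] => n.
  by rewrite -rmorphM lecR; case: (cmp n).
by rewrite -rmorphM lecR; case: (cmp n).
Qed.

Lemma bdiff_le (p : B) : exists2 M : C, 0 <= M &
  posk everywhere (fun x y => M * (bdiff p (@gram R d) x y * kap x y) - bdiff p kap x y).
Proof.
have [r rE] : exists r : R, gram p p = r%:C%C.
  by apply/complex_realP/ger0_real; exact: (posk_diag (x := p) (posk_gram (S := everywhere)) I).
have r0 : 0 <= r by rewrite -ler0c -rE; exact: (posk_diag (x := p) (posk_gram (S := everywhere)) I).
have r1 : r < 1.
  by have := valP p; rewrite /= /in_ball -/(gram p p) rE -(rmorph1 (real_complex R)) ltcR.
(* With [t = e] one has [(1 + e) (1 + e^2) <= 1 + 3 e = 2 - r], and [(2 - r) r < 1] makes the factor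
   [c] below positive. *)
pose e := (1 - r) / 3; have e0 : 0 < e by rewrite divr_gt0 // subr_gt0.
have e1 : e <= 1 by rewrite /e; lra.
have [b [k [M [b0 bA kS M0 [Mk Mkap]]]]] := regular_majorant e0.
pose t : C := e%:C%C; have t0 : 0 < t by rewrite ltcR.
pose A : C := (1 + e)%:C%C; have A0 : 0 <= A by rewrite ler0c addr_ge0 // ltW.
have P1 := bdiff_bound p t0 A0 b0 (fun n => (bA n).1) kS.
pose c := 1 - A * (1 + t ^+ 2) * gram p p; rewrite -/c in P1.
have c0 : 0 < c.
  rewrite /c rE /A /t -rmorphXn -(rmorph1 (real_complex R)) -rmorphD -!rmorphM -rmorphB ltcR /=.
  have h1 : e ^+ 2 <= e by rewrite expr2 ler_piMl // ltW.
  have h2 : (1 + e) * (1 + e ^+ 2) <= 1 + 3 * e.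
    apply: le_trans (_ : (1 + e) * (1 + e) <= _); last by nra.
    by rewrite ler_pM2l ?lerD2l // addr_gt0.
  rewrite subr_gt0; apply: le_lt_trans (_ : (1 + 3 * e) * r < 1); first by rewrite ler_wpM2r.
  have -> : 1 + 3 * e = 2 - r by rewrite /e; lra.
  nra.
pose X := A * (1 + t^-2); rewrite -/X in P1.
have X0 : 0 <= X by rewrite mulr_ge0 // addr_ge0 // invr_ge0 exprn_ge0 // ltW.
have P2 := posk_bdiff p Mk.
have P3 := posk_schur (posk_bdiff p (posk_gram (S := everywhere))) Mkap.
(* The chain is [bdiff kap <= M bdiff k <= (M X / c) bdiff gram * k], and replacing [k] by [M kap]
   costs the second [M]. *)
exists (M * M * X / c); first by apply: divr_ge0 (ltW c0); apply: mulr_ge0 X0; exact: mulr_ge0.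
have Mc0 : 0 <= M / c by rewrite divr_ge0 // ltW.
apply: (posk_eq _ (poskD P2 (poskD (poskZ Mc0 P1) (poskZ (mulr_ge0 Mc0 X0) P3)))) => x y _ _.
by rewrite /bdiff; field; exact: lt0r_neq0.
Qed.

Hypothesis HC : CNP H.

Lemma multZ c f : mult H f -> mult H (fun x => c * f x).
Proof.
move=> Hf h Hh; have := memZ HH c (Hf h Hh); congr mem.
by apply: funext => x; rewrite mulrA.
Qed.

Lemma gleason (p : B) f : mult H f -> f p = 0 -> exists psi : 'I_d -> B -> C,
  (forall j, mult H (psi j)) /\
  forall x, f x = \sum_(j < d) (val x 0 j - val p 0 j) * psi j x.
Proof.
move=> Hf fp; have [M M0 P1] := mult_bounded HH Hf.
have [M' M'0 P2] := bdiff_le p.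
pose N := sqrtC (M * M').
have N2 : N ^+ 2 = M * M' by rewrite sqrtCK.
have Nr : N^* = N by apply/CrealP; rewrite ger0_real // sqrtC_ge0 mulr_ge0.
pose b (j : 'I_d) (x : B) := N * (val x 0 j - val p 0 j).
have P : posk everywhere (fun x y => (\sum_(j < d) (b j x)^* * b j y - (f x)^* * f y) * kap x y).
  (* Since [f p = 0], the difference operation at [p] leaves [conj (f x) f(y) k] unchanged. *)
  apply: (posk_eq _ (poskD (posk_bdiff p P1) (poskZ M0 P2))) => x y _ _.
  have -> : \sum_(j < d) (b j x)^* * b j y = M * M' * bdiff p (@gram R d) x y.
    rewrite -N2 /bdiff /gram /cdot -!sumrB -big_split mulr_sumr; apply: eq_bigr => j _ /=.
    by rewrite /b rmorphM rmorphB /= Nr; ring.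
  by rewrite /bdiff fp rmorph0; ring.
have [psi [psiM psiE]] := leech HH HC P.
exists (fun j x => N * psi j x); split=> [j|x]; first exact: multZ.
by rewrite psiE; apply: eq_bigr => j _; rewrite /b; ring.
Qed.

Lemma cdot_lt (z : 'rV[C]_d) (x : B) : 1 < cdot z z -> `|cdot (val x) z| ^+ 2 < cdot z z.
Proof.
move=> z1; have z0 : 0 < cdot z z := lt_trans ltr01 z1.
(* The point [z] is outside the ball, so the index type gets one extra point for it. *)
pose v (u : B + unit) := if u is inl x then val x else z.
have := posk_CS (posk_cdot (S := fun=> True) v) (supported1 1 (I : everywhere (inr tt : B + unit)))
  (supported1 1 (I : everywhere (inl x : B + unit))).
rewrite !cross11 rmorph1 !mul1r /= -normCK => /le_lt_trans; apply.
by rewrite -[X in _ < X]mulr1 ltr_pM2l //; exact: (valP x).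
Qed.

(* With [u] a strict contraction of norm [th], the factor [1 - u] is bounded below:
   [|1 - u|^2 = |th - u|^2 / th + (1 / th - 1) (th^2 - |u|^2) + (1 - th)^2]. *)
Lemma mult_resolvent (z : 'rV[C]_d) : 1 < cdot z z ->
  mult H (fun x => (cdot z z - cdot (val x) z)^-1).
Proof.
move=> z1; have z0 : 0 < cdot z z := lt_trans ltr01 z1.
have [rho rhoE] : exists r : R, cdot z z = r%:C%C.
  by apply/complex_realP; exact: gtr0_real.
have rho1 : 1 < rho by move: z1; rewrite rhoE -(rmorph1 (real_complex R)) ltcR.
have rho0 : 0 < rho by rewrite (lt_trans ltr01).
pose w := rho^-1; have w0 : 0 < w by rewrite invr_gt0.
have w1 : w < 1 by rewrite invf_lt1.
(* Here [th ^ 2 - w = (1 - w) ^ 2 / 4], which is taken as [e]; then [(1 + e) * w <= th ^ 2]. *)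
pose th := (1 + w) / 2; have th0 : 0 < th by rewrite divr_gt0 // addr_gt0.
have th1 : th < 1 by rewrite /th; lra.
pose e := (1 - w) ^+ 2 / 4.
have e0 : 0 < e by rewrite divr_gt0 // exprn_gt0 // subr_gt0.
have ew : (1 + e) * w <= th ^+ 2.
  rewrite mulrDl mul1r -lerBrDl; apply: le_trans (_ : e <= _); first by rewrite ler_piMr // ltW.
  by rewrite le_eqVlt; apply/orP; left; apply/eqP; rewrite /e /th; field.
have [b [k [M [b0 bA kS M0 [Mk Mkap]]]]] := regular_majorant e0.
have A0 : 0 <= (1 + e)%:C%C :> C by rewrite ler0c addr_ge0 // ltW.
have kp := kseries_posk (S := everywhere) b0 kS.
have P1 := gram_shift A0 b0 (fun n => (bA n).2) kS.
pose u (x : B) := cdot (val x) z / cdot z z.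
have uE x : (u x)^* = cdot z (val x) / cdot z z.
  rewrite /u rmorphM fmorphV /=; congr (_ / _); last by apply/CrealP; exact: gtr0_real.
  by rewrite /cdot rmorph_sum; apply: eq_bigr => j _; rewrite rmorphM /= conjCK mulrC.
pose T : C := th%:C%C; have T0 : 0 < T by rewrite ltcR.
have T1 : T < 1 by rewrite -(rmorph1 (real_complex R)) ltcR.
have Tr : T^* = T by apply/CrealP; exact: gtr0_real.
have P2 : posk everywhere (fun x y => gram x y - cdot z z * ((u x)^* * u y)).
  pose v (q : B + unit) := if q is inl x then val x else z.
  have Pv := posk_compl (x0 := inr tt) (posk_cdot (S := fun=> True) v) I.
  have Pc := @posk_comp _ _ _ _ everywhere _ (fun x : B => inl x : B + unit) Pv (fun _ _ => I).
  apply: (posk_eq _ Pc) => x y _ _.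
  rewrite /= uE /gram /u.
  by field; exact: lt0r_neq0.
have wC : (cdot z z)^-1 = w%:C%C by rewrite rhoE -fmorphV.
have P3 : posk everywhere (fun x y => T ^+ 2 * k x y - (u x)^* * u y * k x y).
  have h : 0 <= T ^+ 2 - (1 + e)%:C%C * w%:C%C by rewrite subr_ge0 -rmorphXn -rmorphM lecR.
  have w0' : 0 <= w%:C%C :> C by rewrite ler0c ltW.
  apply: (posk_eq _ (poskD (poskZ h kp) (poskD (poskZ w0' P1) (poskZ w0' (posk_schur P2 kp))))) => x y _ _.
  rewrite -wC; field; exact: lt0r_neq0.
have P4 : posk everywhere (fun x y => (1 - (u x)^*) * (1 - u y) * k x y - (1 - T) ^+ 2 * k x y).
  have Ti : 0 <= T^-1 by rewrite invr_ge0 ltW.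
  have Ti1 : 0 <= T^-1 - 1 by rewrite subr_ge0 invf_ge1 // ltW.
  apply: (posk_eq _ (poskD (poskZ Ti (posk_congr (fun x => T - (u x)^*) kp)) (poskZ Ti1 P3))) => x y _ _.
  by rewrite rmorphB /= conjCK Tr; field; exact: lt0r_neq0.
have u1 x : 1 - u x != 0.
  rewrite /u subr_eq0 eq_sym; apply/eqP => ux.
  have := cdot_lt x z1; have -> : cdot (val x) z = cdot z z.
    by rewrite -[RHS]mul1r -ux divfK // lt0r_neq0.
  rewrite ger0_norm ?ltW // expr2 -[X in _ < X]mulr1 ltr_pM2l // => h.
  by have := lt_trans h z1; rewrite ltxx.
pose psi x := (1 - u x)^-1.
(* Dividing by [(1 - conj (u x)) (1 - u y)] turns the lower bound for [1 - u] into an upper bound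
   for its inverse. *)
have P5 := posk_congr (fun x => (psi x)^*) P4.
have T2 : 0 < (1 - T) ^+ 2 by rewrite exprn_gt0 // subr_gt0.
have psiM : mult H psi.
  apply: (mult_of_posk HH (M := M * M / (1 - T) ^+ 2)).
    by apply: divr_ge0 (ltW T2); exact: mulr_ge0.
  have MT : 0 <= M / (1 - T) ^+ 2 by rewrite divr_ge0 // ltW.
  apply: (posk_eq _ (poskD (posk_congr (fun x => (psi x)^*) Mk)
    (poskD (poskZ MT P5) (poskZ MT Mkap)))) => x y _ _.
  rewrite !conjCK /psi fmorphV rmorphB rmorph1 /=.
  have u1' : 1 - (u x)^* != 0 by rewrite -(rmorph1 (@Num.conj C)) -rmorphB conjC_eq0.
  have T1' : 1 - T != 0 by rewrite subr_eq0 eq_sym lt_eqF.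
  by field; rewrite u1 u1' T1'.
have := multZ (cdot z z)^-1 psiM; congr mult; apply: funext => x.
rewrite /psi -invfM; congr (_^-1); rewrite /u.
by field; exact: lt0r_neq0.
Qed.

End RegularSpace.

(** * Supports of ideals *)

Section Support.
Variables (R : realType) (d : nat) (a : nat -> R) (H : rkhs R d).
Hypothesis HH : is_rkhs_of a H.
Implicit Types (A : fn R d -> Prop) (f g : fn R d) (z : 'rV[R[i]]_d).

Lemma mult_cst (c : R[i]) : mult H (fun=> c).
Proof. by move=> h Hh; exact: (memZ HH). Qed.

Lemma multD f g : mult H f -> mult H g -> mult H (fun x => f x + g x).
Proof.
move=> Hf Hg h Hh; have := memD HH (Hf h Hh) (Hg h Hh); congr mem.
by apply: funext => x; rewrite mulrDl.
Qed.

Lemma multM f g : mult H f -> mult H g -> mult H (fun x => f x * g x).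
Proof.
move=> Hf Hg h Hh; have := Hf _ (Hg h Hh); congr mem.
by apply: funext => x; rewrite mulrA.
Qed.

Lemma ideal_sum A (n : nat) (F : 'I_n -> fn R d) : ideal H A -> (forall i, A (F i)) ->
  A (fun x => \sum_(i < n) F i x).
Proof.
move=> [_ [A0 [AD _]]] AF; elim: n F AF => [|n IH] F AF.
  by have := A0; congr A; apply: funext => x; rewrite big_ord0.
have := AD _ _ (AF ord0) (IH _ (fun i => AF (lift ord0 i))); congr A.
by apply: funext => x; rewrite big_ord_recl.
Qed.

Lemma prod_ideal_sub A (A' : fn R d -> Prop) f : ideal H A -> ideal H A' -> prod_ideal A A' f -> A f /\ A' f.
Proof.
move=> iA iA' [n [g [h [gh ->]]]].
have [[mA [_ [_ sA]]] [mA' [_ [_ sA']]]] := (iA, iA').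
split; apply: ideal_sum => // i; have [Ag Ah] := gh i; last exact: sA' (mA _ Ag) Ah.
have := sA _ _ (mA' _ Ah) Ag; congr A; apply: funext => x; exact: mulrC.
Qed.

Lemma supp_anti A (A' : fn R d -> Prop) z : (forall f, A f -> A' f) -> supp H A' z -> supp H A z.
Proof.
by move=> sub nA' [phi [psi [Aphi h]]]; apply: nA'; exists phi, psi; split=> //; exact: sub.
Qed.

(* Multiplying [1 = phi + i] and [1 = phi' + i'] gives [1 = phi phi' + (i + phi i')]. *)
Lemma supp_prod A (A' : fn R d -> Prop) z : ideal H A -> ideal H A' -> supp H (prod_ideal A A') z ->
  supp H A z \/ supp H A' z.
Proof.
move=> iA iA' sz; apply: contrapT => /not_orP[].
move=> /contrapT[phi [psi [Aphi [mpsi e]]]] /contrapT[phi' [psi' [Aphi' [mpsi' e']]]].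
apply: sz; exists (fun x => phi x * phi' x), (fun j x => psi j x + phi x * psi' j x).
split; first by exists 1%N, (fun=> phi), (fun=> phi'); split=> //;
  apply: funext => x; rewrite big_ord1.
split=> [j|]; first by apply: multD => //; apply: multM => //; case: iA => mA _; exact: mA.
apply: funext => x; have := congr1 (@^~ x) e; have := congr1 (@^~ x) e' => /=.
set s' := \sum_(j < d) _ => h'; set s := \sum_(j < d) _ => h.
have -> : \sum_(j < d) (coordf j x - z 0 j) * (psi j x + phi x * psi' j x) = s + phi x * s'.
  by rewrite mulr_sumr -big_split; apply: eq_bigr => j _ /=; ring.
by rewrite addrCA -mulrDr h' mulr1 addrC.
Qed.

Lemma sub_wclosure A f : (forall g, A g -> mult H g) -> A f -> wclosure H A f.
Proof.
move=> mA Af; split=> [|k x y xy eps eps0]; first exact: mA.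
exists f; split=> // i s /(_ eps eps0)[N /(_ N (leqnn N))].
have [[mx _] [my _]] := xy i.
rewrite big1 ?sub0r ?normrN // => n _.
rewrite -[RHS](mul0r (ip H (x i n) (y i n))) -(ipZl HH) //.
by congr ip; apply: funext => t; rewrite subrr.
Qed.

Lemma wclosure_sub A (A' : fn R d -> Prop) f : (forall g, A g -> A' g) -> wclosure H A f -> wclosure H A' f.
Proof.
move=> sub [mf h]; split=> // k x y xy eps /(h k x y xy)[phi [Aphi e]].
by exists phi; split=> //; exact: sub.
Qed.

Hypotheses (HR : regular_coeffs a) (HC : CNP H).

Lemma supp_ball A z (hz : in_ball z) : ideal H A ->
  supp H A z <-> zero_set A (exist _ z hz).
Proof.
move=> [mA [_ [_ sA]]]; split=> [sz f Af|Z [phi [psi [Aphi [_ /(congr1 (@^~ (exist _ z hz)))]]]]].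
  apply: contrapT => /eqP fp0; apply: sz; set p := exist _ z hz in fp0.
  pose g x := 1 + - (f p)^-1 * f x.
  have mg : mult H g by apply: multD; [exact: mult_cst|apply: (multZ HH); exact: mA].
  have gp : g p = 0 by rewrite /g mulNr mulVf // subrr.
  have [psi [mpsi gE]] := gleason HH HR HC mg gp.
  exists (fun x => (f p)^-1 * f x), psi; split; first exact: sA (mult_cst _) Af.
  split=> //; apply: funext => x; rewrite -gE /g; ring.
rewrite /= Z // big1 => [/eqP|j _]; last by rewrite /coordf subrr mul0r.
by rewrite addr0 eq_sym oner_eq0.
Qed.

Lemma supp_cball A z : ideal H A -> supp H A z -> in_cball z.
Proof.
move=> [_ [A0 _]] sz; apply: contrapT => /negP; rewrite /in_cball => z1.
have zr : cdot z z \is Num.real.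
  by apply: ger0_real; apply: sumr_ge0 => j _; exact: mul_conjC_ge0.
move: z1; rewrite -real_ltNge ?rpred1 // => z1.
(* The sum of [(x_j - z_j) * - conj z_j] is [|z|^2 - <x, z>], whose inverse is the resolvent
   multiplier. *)
apply: sz; exists (fun=> 0), (fun j x => - (z 0 j)^* * (cdot z z - cdot (val x) z)^-1).
split=> //; split=> [j|]; first exact: (multZ HH _ (mult_resolvent HH HR z1)).
apply: funext => x; rewrite add0r.
have n0 : cdot z z - cdot (val x) z != 0.
  rewrite subr_eq0; apply/eqP => e; have := cdot_lt x z1; rewrite -e.
  rewrite ger0_norm ?(le_trans ler01 (ltW z1)) // expr2 -[X in _ < X]mulr1 ltr_pM2l ?(lt_trans ltr01 z1) //.
  by move=> /(lt_trans z1); rewrite ltxx.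
rewrite -[RHS](mulfV n0) {1}/cdot /cdot -sumrB mulr_suml.
by apply: eq_bigr => j _; rewrite /coordf; ring.
Qed.

End Support.

Local Open Scope complex_scope.

Theorem theorem3p4 (R : realType) (d : nat) (a : nat -> R) (H : rkhs R d) :
  (0 < d)%N -> regular_coeffs a -> is_rkhs_of a H -> CNP H ->
  (* (i) *)
  (forall A, ideal H A ->
     (forall (z : 'rV[R[i]]_d) (hz : in_ball z),
        supp H A z <-> zero_set A (exist _ z hz)) /\
     (forall z, supp H A z -> in_cball z)) /\
  (* (ii) *)
  (forall A B, ideal H A -> ideal H B -> (forall f, A f -> B f) ->
     forall z, supp H B z -> supp H A z) /\
  (* (iii) *)
  (forall A B, ideal H A -> ideal H B ->
     (forall z, supp H (cap_ideal A B) z <-> (supp H A z \/ supp H B z)) /\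
     (forall z, (supp H A z \/ supp H B z) <-> supp H (prod_ideal A B) z) /\
     (forall z, supp H (sum_ideal A B) z -> supp H A z /\ supp H B z)) /\
  (* (iv) *)
  (forall A B, ideal H A -> ideal H B -> wclosed H A -> wclosed H B ->
     forall z, supp H (prod_ideal A B) z <->
               supp H (wclosure H (prod_ideal A B)) z).
Proof.
move=> _ HR HH HC; split=> [A iA|].
  by split=> [z hz|z]; [exact: supp_ball HH HR HC A z hz iA|exact: supp_cball HH HR A z iA].
split=> [A B _ _ AB z|]; first exact: supp_anti.
split=> [A B iA iB|A B iA iB cA cB z].
  have prodA f : prod_ideal A B f -> A f by case/(prod_ideal_sub iA iB).
  have prodB f : prod_ideal A B f -> B f by case/(prod_ideal_sub iA iB).
  have sup_prod z : supp H A z \/ supp H B z -> supp H (prod_ideal A B) z.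
    by case; exact: supp_anti.
  split=> [z|]; last split=> [z|z sz].
  - split=> [sz|].
      by apply: (supp_prod HH iA iB); apply: supp_anti sz => f; exact: (prod_ideal_sub iA iB).
    by case; apply: supp_anti => f [].
  - by split=> [/sup_prod//|]; exact: (supp_prod HH iA iB).
  case: iA iB => [_ [A0 _]] [_ [B0 _]]; split; apply: supp_anti sz => f Ff.
    by exists f, (fun=> 0); split=> //; split=> //; apply: funext => x; rewrite addr0.
  by exists (fun=> 0), f; split=> //; split=> //; apply: funext => x; rewrite add0r.
split; last first.
  apply: supp_anti => f; apply: (sub_wclosure HH) => g /(prod_ideal_sub iA iB)[/iA.1].
  by [].
(* Being weak-* closed, [A] and [B] each contain the closure of the product, so both of their
   supports lie in the support of that closure. *)
move=> /(supp_prod HH iA iB)[]; apply: supp_anti => f wf.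
  by apply: cA; apply: wclosure_sub wf => g /(prod_ideal_sub iA iB)[].
by apply: cB; apply: wclosure_sub wf => g /(prod_ideal_sub iA iB)[].
Qed.
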